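(* For every $y_0\in Y$, $$\hat d^*(y_0)\le \liminf_{T\to\infty} v_T(y_0)\le \limsup_{T\to\infty} v_T(y_0)\le k^*(y_0)$$ and $$\hat d^*(y_0)\le \liminf_{\epsilon\to 0} h_\epsilon(y_0)\le \limsup_{\epsilon\to 0} h_\epsilon(y_0)\le k^*(y_0).$$
   Context: Model. $Y\subset\mathbb R^n$ is a nonempty compact set, $\hat U$ is a compact metric space, $S$ is a Polish space. The function $f:Y\times\hat U\times S\to\mathbb R^n$ is bounded, continuous in $(y,u)$ on $Y\times\hat U$ and Borel measurable in $s$ on $S$. The $S$-valued random elements $s(0),s(1),\dots$ are independent and identically distributed on a common probability space; $s$ denotes a generic random element with the same distribution, and $E[\varphi(f(y,u,s))]$ is the expectation over $s$ with $(y,u)$ fixed. $U(\cdot)$ is an upper semicontinuous multivalued map from $Y$ to nonempty compact subsets of $\hat U$, and $f(y,u,s)\in Y$ for all $y\in Y$, $u\in U(y)$, $s\in S$. $G:=\{(y,u): y\in Y,\ u\in U(y)\}$ (a compact set). $\Pi$ is the set of control plans $\pi=\{\pi_t(\cdot)\}_{t=0,1,\dots}$, where each $\pi_t:Y\to\hat U$ is Borel measurable with $\pi_t(y)\in U(y)$ for all $y\in Y$. For $\pi\in\Pi$ and $y_0\in Y$, the state-control trajectory $(y^{\pi,y_0}(\cdot),u^{\pi,y_0}(\cdot))$ is defined by $y(0)=y_0$, $u(t)=\pi_t(y(t))$, $y(t+1)=f(y(t),u(t),s(t))$. The function $k:Y\times\hat U\to\mathbb R$ is continuous (hence bounded). Optimal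 values. For $T=1,2,\dots$ and $\epsilon\in(0,1)$, $$v_T(y_0):=\frac1T\min_{\pi\in\Pi}E\Big[\sum_{t=0}^{T-1}k(y^{\pi,y_0}(t),u^{\pi,y_0}(t))\Big],\qquad h_\epsilon(y_0):=\epsilon\min_{\pi\in\Pi}E\Big[\sum_{t=0}^{\infty}(1-\epsilon)^t k(y^{\pi,y_0}(t),u^{\pi,y_0}(t))\Big].$$ Spaces. $\mathcal P(G)$ and $\mathcal M_+(G)$ are the sets of probability measures and of finite nonnegative measures on the Borel subsets of $G$; $C(Y)$ is the space of continuous functions and $\mathcal B(Y)$ the space of bounded Borel functions on $Y$. Augmented problem. $W:=\{\gamma\in\mathcal P(G): \int_G(E[\varphi(f(y,u,s))]-\varphi(y))\gamma(dy,du)=0\ \ \forall\varphi\in C(Y)\}$. $\Omega(y_0)$ is the set of $(\gamma,\xi)\in\mathcal P(G)\times\mathcal M_+(G)$ such that $\gamma\in W$ and $\int_G(\varphi(y_0)-\varphi(y))\gamma(dy,du)+\int_G(E[\varphi(f(y,u,s))]-\varphi(y))\xi(dy,du)=0$ for all $\varphi\in C(Y)$. $$k^*(y_0):=\inf_{(\gamma,\xi)\in\Omega(y_0)}\int_G k(y,u)\gamma(dy,du).$$ Dual. $\hat d^*(y_0)$ is the supremum of $\mu$ over all triplets $(\mu,\psi,\eta)\in\mathbb R\times\mathcal B(Y)\times\mathcal B(Y)$ such that for all $(y,u)\in G$: $k(y,u)+(\psi(y_0)-\psi(y))+E[\eta(f(y,u,s))]-\eta(y)-\mu\ge0$ and $E[\psi(f(y,u,s))]-\psi(y)\ge0$.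 Infimum over the empty set is $+\infty$. *)

(* Defs.v *)
From HB Require Import structures.
From mathcomp Require Import all_boot all_order all_algebra finmap.
From mathcomp Require Import all_classical all_reals all_analysis.
Import Order.TTheory GRing.Theory Num.Theory.
Import numFieldNormedType.Exports.

Set Implicit Arguments.
Unset Strict Implicit.
Unset Printing Implicit Defensive.

Local Open Scope classical_set_scope.
Local Open Scope ring_scope.

(* The library's measurable types are pointed, hence so are the spaces on which
   Borel sigma-algebras are considered below. *)
#[short(type="pmetricType")]
HB.structure Definition PointedMetric (K : numDomainType) :=
  {M of Pointed M & Metric K M}.

Notation borel T := (g_sigma_algebraType (@open T)).

Definition polish_space (R : realType) (T : topologicalType) : Prop :=
  (exists2 D : set T, countable D & dense D) /\
  exists dist : T -> T -> R,
    [/\ [/\ forall x, dist x x = 0,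
            forall x y, dist x y = 0 -> x = y,
            forall x y, dist x y = dist y x &
            forall x y z, dist x z <= dist x y + dist y z],
        forall (x : T) (A : set T),
          nbhs x A <-> exists2 e, 0 < e & [set y | dist x y < e] `<=` A &
        forall a : nat -> T,
          (forall e, 0 < e -> exists N : nat, forall i j : nat,
             (N <= i)%N -> (N <= j)%N -> dist (a i) (a j) < e) ->
          exists l : T, a @ \oo --> l].

Definition upper_semicontinuous (X Z : topologicalType) (Y : set X)
    (U : X -> set Z) : Prop :=
  forall y, Y y -> forall V : set Z, open V -> U y `<=` V ->
    \forall y' \near within Y (nbhs y), U y' `<=` V.

Definition iid d (Om : measurableType d) (R : realType) (P : probability Om R)
    (S : ptopologicalType) (s : nat -> Om -> S) : Prop :=
  [/\ forall t, measurable_fun [set: Om] (s t : Om -> borel S),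
      forall t (B : set (borel S)), measurable B ->
        P (s t @^-1` B) = P (s 0%N @^-1` B) &
      forall (J : {fset nat}) (B : nat -> set (borel S)),
        (forall t, measurable (B t)) ->
        P (\bigcap_(t in [set` J]) (s t @^-1` B t)) =
        (\prod_(t <- J) P (s t @^-1` B t))%E].

(* C(Y) and B(Y); functions on Y are represented by functions on the whole space
   of which only the values on Y are constrained (and used). *)
Definition contY (R : realType) n (Y : set 'rV[R]_n) (phi : 'rV[R]_n -> R) :=
  {within Y, continuous phi}.

Definition bounded_borelY (R : realType) n (Y : set 'rV[R]_n)
    (phi : 'rV[R]_n -> R) : Prop :=
  measurable_fun (Y : set (borel 'rV[R]_n)) (phi : borel 'rV[R]_n -> R) /\
  exists M : R, forall y, Y y -> `|phi y| <= M.

Section Model.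
Context (R : realType) (n : nat) (Uhat : pmetricType R) (S : ptopologicalType).
Context d (Om : measurableType d) (P : probability Om R) (s : nat -> Om -> S).
Variables (Y : set 'rV[R]_n) (f : 'rV[R]_n -> Uhat -> S -> 'rV[R]_n).
Variables (U : 'rV[R]_n -> set Uhat) (k : 'rV[R]_n -> Uhat -> R).

(* E[phi(f(y,u,s))]; the generic s is taken to be s(0). *)
Definition Enext (phi : 'rV[R]_n -> R) (y : 'rV[R]_n) (u : Uhat) : R :=
  \int[P]_w phi (f y u (s 0%N w)).

Definition plan (pi : nat -> 'rV[R]_n -> Uhat) : Prop :=
  forall t,
    measurable_fun (Y : set (borel 'rV[R]_n))
      (pi t : borel 'rV[R]_n -> borel Uhat) /\
    forall y, Y y -> U y (pi t y).

Fixpoint state (pi : nat -> 'rV[R]_n -> Uhat) (y0 : 'rV[R]_n) (t : nat) (w : Om)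
    : 'rV[R]_n :=
  if t is t'.+1 then
    let y := state pi y0 t' w in f y (pi t' y) (s t' w)
  else y0.

Definition control pi y0 t w : Uhat := pi t (state pi y0 t w).

Definition stage_cost pi y0 t w : R := k (state pi y0 t w) (control pi y0 t w).

(* The minima over plans are rendered as infima in \bar R. *)
Definition v (T : nat) (y0 : 'rV[R]_n) : \bar R :=
  ((T%:R^-1)%:E * ereal_inf
    [set (\int[P]_w \sum_(t < T) stage_cost pi y0 t w)%:E | pi in plan])%E.

Definition h (eps : R) (y0 : 'rV[R]_n) : \bar R :=
  (eps%:E * ereal_inf
    [set (\int[P]_w limn (series
            (fun t => (1 - eps) ^+ t * stage_cost pi y0 t w)))%:E
    | pi in plan])%E.

Definition G : set (borel ('rV[R]_n * Uhat)%type) :=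
  [set p | Y p.1 /\ U p.1 p.2].

(* A measure on the Borel subsets of G is represented by a Borel measure on
   R^n x Uhat for which the complement of G is null (extension by zero). *)
Definition on_G (m : set (borel ('rV[R]_n * Uhat)%type) -> \bar R) : Prop :=
  m (~` G) = 0%E.

Definition W (gamma : probability (borel ('rV[R]_n * Uhat)%type) R) : Prop :=
  on_G gamma /\
  forall phi, contY Y phi ->
    \int[gamma]_(p in G) (Enext phi p.1 p.2 - phi p.1) = 0.

Definition Omega (y0 : 'rV[R]_n)
    (gamma : probability (borel ('rV[R]_n * Uhat)%type) R)
    (xi : {finite_measure set (borel ('rV[R]_n * Uhat)%type) -> \bar R})
    : Prop :=
  [/\ on_G gamma, on_G xi, W gamma &
      forall phi, contY Y phi ->
        \int[gamma]_(p in G) (phi y0 - phi p.1) +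
        \int[xi]_(p in G) (Enext phi p.1 p.2 - phi p.1) = 0].

Definition kstar (y0 : 'rV[R]_n) : \bar R :=
  ereal_inf [set x | exists gamma xi, Omega y0 gamma xi /\
                       x = (\int[gamma]_(p in G) k p.1 p.2)%:E].

Definition dual_feasible (y0 : 'rV[R]_n) (mu : R)
    (psi eta : 'rV[R]_n -> R) : Prop :=
  [/\ bounded_borelY Y psi, bounded_borelY Y eta &
      forall y u, Y y -> U y u ->
        0 <= k y u + (psi y0 - psi y) + Enext eta y u - eta y - mu /\
        0 <= Enext psi y u - psi y].

Definition dhat (y0 : 'rV[R]_n) : \bar R :=
  ereal_sup [set x | exists mu psi eta, dual_feasible y0 mu psi eta /\
                       x = mu%:E].

End Model.

(* Main.v *)
Require Import Defs.
From HB Require Import structures.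
From mathcomp Require Import all_boot all_order all_algebra finmap.
From mathcomp Require Import all_classical all_reals all_analysis.
From mathcomp Require Import measurable_realfun ring lra.
Import Order.TTheory GRing.Theory Num.Theory.
Import numFieldNormedType.Exports.

Local Open Scope classical_set_scope.
Local Open Scope ring_scope.

(* Both criteria are handled at once through the sums of alpha^t k(y(t), u(t)),
   with alpha = 1 for v_T and alpha = 1 - epsilon for h_epsilon.

   Lower bounds: along any plan, independence of s(t) from y(t) turns the dual
   constraints into inequalities between expectations; E psi(y(t)) is
   nondecreasing in t, and the eta-terms telescope up to 2 sup |eta|.

   Upper bounds: let V_0 = 0 and V_{m+1}(y) be the minimum over U(y) of
   k + alpha E[V_m(f)].  V_m is lower semicontinuous, the minimum is attained by
   a Borel selector, so V_m(y0) is at least the cost of an admissible plan.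
   Bounded semicontinuous functions are limits of continuous ones, hence are
   legitimate test functions for (gamma, xi) in Omega(y0).  As gamma is in W,
   integrating V_{m+1} <= k + alpha E[V_m(f)] gives that the gamma-integral of V_m
   is at most (1 + ... + alpha^(m-1)) times that of k, and the second equation of
   Omega(y0) expresses V_m(y0) as that integral minus the xi-integral of
   E[V_m(f)] - V_m >= - 3 sup |k|.  The last term is bounded uniformly in m and
   disappears after normalisation. *)

Set Implicit Arguments.
Unset Strict Implicit.
Unset Printing Implicit Defensive.

(** * Borel measurability and measurable selection *)

(* The joins of the pointed structure with the (pseudo)metric ones are not declared
   for products and matrices in the library. *)
HB.saturate prod.
HB.saturate matrix.

(** A cluster point of any choice of representatives works, since the tail from [i] on lies in the
    closed set [A i]. *)
Lemma compact_nested {T : topologicalType} (A : nat -> set T) :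
  compact (A 0%N) -> (forall i j, (i <= j)%N -> A j `<=` A i) ->
  (forall i, closed (A i)) -> (forall i, A i !=set0) ->
  exists x, forall i, A i x.
Proof.
move=> A0 Adec Acl Ane.
have /choice[x Ax] := Ane.
have [|p [_ clp]] := A0 (x @ \oo) _.
  by exists 0%N => // j /= j0; exact: (Adec _ _ j0).
exists p => i; apply: Acl => B Bp.
by apply: clp => //; exists i => // j /= ij; exact: (Adec _ _ ij).
Qed.

(** Lower semicontinuity enters as closedness of the sublevel sets in [K]. A minimiser is a common
    point of the nested sublevel sets at heights [1/(i+1)] above the infimum. *)
Lemma compact_argmin {T : topologicalType} {R : realType} (K : set T)
    (g : T -> R) :
  compact K -> K !=set0 -> (forall c, closed (K `&` [set x | g x <= c])) ->
  (exists B, forall x, K x -> B <= g x) ->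
  exists2 x, K x & forall y, K y -> g x <= g y.
Proof.
move=> Kc Kne Kcl [B gB].
pose m := inf (g @` K).
have gne : (g @` K) !=set0 by case: Kne => x Kx; exists (g x), x.
have glb : has_lbound (g @` K) by exists B => _ [x Kx <-]; exact: gB.
have mle y : K y -> m <= g y by move=> Ky; apply: ge_inf => //; exists y.
pose A i := K `&` [set x | g x <= m + i.+1%:R^-1].
have [||||x Ax] := @compact_nested T A.
- by apply: subclosed_compact (Kcl _) Kc _ => x [].
- move=> i j ij x [Kx gx]; split => //=; apply: le_trans gx _.
  by rewrite lerD2l lef_pV2 ?posrE// ler_nat.
- by move=> i; exact: Kcl.
- move=> i.
  have [_ [x Kx <-] xlt] := @inf_adherent _ (g @` K) i.+1%:R^-1 (ltac:(by [])) (conj gne glb).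
  by exists x; split => //; exact: ltW.
exists x; first by case: (Ax 0%N).
move=> y Ky; apply: le_trans (mle _ Ky).
apply/ler_addgt0Pl => e e0.
have [i _ ie] := near_infty_natSinv_lt (PosNum e0).
rewrite addrC; apply: le_trans (Ax i).2 _.
by rewrite lerD2l; apply: ltW; exact: (ie i (leqnn _)).
Qed.


(** Finite nets, listed as sequences padded with [x0]; they play the role of a countable base below.
    Interiors are taken because [ball] need not be open. *)
Lemma compact_net {R : realType} {X : pseudoPMetricType R} (K : set X) (x0 : X) :
  K x0 -> compact K ->
  exists net : nat -> nat -> X, (forall m i, K (net m i)) /\
    forall m x, K x -> exists i, (ball (net m i) m.+1%:R^-1)° x.
Proof.
move=> Kx0; rewrite compact_cover => Kc.
suff /choice[net netP] : forall m : nat, exists g : nat -> X, (forall i, K (g i)) /\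
    forall x, K x -> exists i, (ball (g i) m.+1%:R^-1)° x.
  by exists net; split=> m; case: (netP m).
move=> m.
have [||D DK cov] := Kc X K (fun x => (ball x m.+1%:R^-1)°).
- by move=> i _; exact: open_interior.
- move=> x Kx; exists x => //; exact: nbhsx_ballx.
exists (fun i => nth x0 (enum_fset D) i); split=> [i|x Kx].
  have [iD|iD] := ltnP i (size (enum_fset D)); last by rewrite nth_default.
  by have := DK (nth x0 (enum_fset D) i); rewrite inE; apply; exact: mem_nth.
have [y /= yD xy] := cov x Kx; exists (index y (enum_fset D)).
by rewrite nth_index.
Qed.

Lemma closed_within_preimage {T Z : topologicalType} (K : set T) (g : T -> Z)
    (C : set Z) :
  closed K -> {within K, continuous g} -> closed C -> closed (K `&` g @^-1` C).
Proof.
move=> Kcl gc Ccl; rewrite closed_setSI//.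
exact: (proj1 (continuous_closedP (g : subspace K -> Z)) gc).
Qed.

Section borel_measurability.
Context {R : realType}.

Lemma open_measurable_borel {X : ptopologicalType} (A : set X) :
  open A -> measurable (A : set (borel X)).
Proof. by move=> oA; exact: sub_sigma_algebra. Qed.

Lemma closed_measurable_borel {X : ptopologicalType} (A : set X) :
  closed A -> measurable (A : set (borel X)).
Proof.
move=> cA; rewrite -[A]setCK; apply: measurableC.
by apply: open_measurable_borel; exact: closed_openC.
Qed.

Lemma measurable_fun_borel {d} {T : measurableType d} {X : ptopologicalType}
    (D : set T) (g : T -> X) :
  (forall O : set X, open O -> measurable (D `&` g @^-1` O)) ->
  measurable_fun D (g : T -> borel X).
Proof.
move=> gO; apply: (@measurability _ _ T (borel X) D g open) => //.
by move=> _ [V oV <-]; exact: gO.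
Qed.

Lemma measurable_fun_borel_closed {d} {T : measurableType d}
    {X : ptopologicalType} (D : set T) (g : T -> X) : measurable D ->
  (forall C : set X, closed C -> measurable (D `&` g @^-1` C)) ->
  measurable_fun D (g : T -> borel X).
Proof.
move=> mD gC; apply: measurable_fun_borel => O oO.
rewrite (_ : _ `&` _ = D `\` (D `&` g @^-1` (~` O))).
  by apply: measurableD => //; apply: gC; exact: open_closedC.
apply/seteqP; split => t /= [Dt Ot]; split => //; first by case.
by apply: contrapT => nO; apply: Ot.
Qed.

Lemma measurable_fun_borelR {d} {T : measurableType d} (D : set T) (g : T -> R) :
  measurable D -> (forall c, measurable (D `&` [set t | g t <= c])) ->
  measurable_fun D g.
Proof.
move=> mD mg _; apply: (measurability _ (RGenOInfty.measurableE R)) => //.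
move=> _ [_ [c ->] <-].
rewrite (_ : _ `&` _ = D `\` (D `&` [set t | g t <= c])); first exact: measurableD.
apply/seteqP; split => t /=.
  by rewrite in_itv/= andbT => -[Dt ct]; split => // -[_]; rewrite leNgt ct.
move=> [Dt nt]; split => //; rewrite in_itv/= andbT ltNge.
by apply/negP => ct; apply: nt.
Qed.

(** The target carries the Borel sigma-algebra of the product topology, which may be larger than the
    product sigma-algebra. Compactness of [K1] and [K2] gives countable nets, so the preimage of an
    open set is a countable union of preimages of rectangles. *)
Lemma measurable_fun_pair_borel {d} {T : measurableType d}
    {X1 X2 : pseudoPMetricType R} (K1 : set X1) (K2 : set X2)
    (D : set T) (a : T -> X1) (b : T -> X2) :
  compact K1 -> compact K2 -> measurable D ->
  (forall t, D t -> K1 (a t)) -> (forall t, D t -> K2 (b t)) ->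
  measurable_fun D (a : T -> borel X1) -> measurable_fun D (b : T -> borel X2) ->
  measurable_fun D ((fun t => (a t, b t)) : T -> borel (X1 * X2)%type).
Proof.
move=> K1c K2c mD aK bK ma mb.
have [->|/set0P[t0 Dt0]] := eqVneq D set0; first exact: measurable_fun_set0.
have [n1 [n1K n1P]] := compact_net (aK _ Dt0) K1c.
have [n2 [n2K n2P]] := compact_net (bK _ Dt0) K2c.
apply: (@measurable_fun_borel _ T (X1 * X2)%type) => O oO.
pose B1 m i := (ball (n1 m i) m.+1%:R^-1)°.
pose B2 m i := (ball (n2 m i) m.+1%:R^-1)°.
rewrite (_ : _ `&` _ = \bigcup_m \bigcup_i
    \bigcup_(j in [set j | B1 m i `*` B2 m j `<=` O])
     ((D `&` a @^-1` B1 m i) `&` (D `&` b @^-1` B2 m j))).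
  apply: bigcupT_measurable => m; apply: bigcupT_measurable => i.
  apply: bigcup_measurable => j _; apply: measurableI.
    by apply: ma => //; apply: open_measurable_borel; exact: open_interior.
  by apply: mb => //; apply: open_measurable_borel; exact: open_interior.
apply/seteqP; split => [t [Dt Ot]|t [m _ [i _ [j sub [[Dt B1t] [_ B2t]]]]]]; last first.
  by split => //; exact: sub.
have := oO; rewrite openE => /(_ _ Ot) /nbhs_ballP[e /= e0 eO].
have [m _ me] := near_infty_natSinv_lt (PosNum (divr_gt0 e0 (ltr0n _ 2))).
have {me} : m.+1%:R^-1 < e / 2 by exact: (me m (leqnn _)).
move=> me; have [i ai] := n1P m _ (aK _ Dt); have [j bj] := n2P m _ (bK _ Dt).
exists m => //; exists i => //; exists j; last by [].
move=> [p q] [/= /interior_subset pi /interior_subset qj]; apply: eO; split => /=.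
  apply: (@ball_splitr _ _ (n1 m i)).
    by apply: le_ball (ltW me) _ _; exact: interior_subset.
  by apply: le_ball (ltW me) _ _.
apply: (@ball_splitr _ _ (n2 m j)).
  by apply: le_ball (ltW me) _ _; exact: interior_subset.
by apply: le_ball (ltW me) _ _.
Qed.

(** By continuity in [x], [g x z] lies in an open [O] exactly when, for some [l] and at all fine
    enough scales, [g] at every net point close to [x] lies in the closed inner approximation
    [O_ l]. Only countably many points of [K] are involved. *)
Lemma caratheodory_measurable {d} {Z : measurableType d}
    {X E : pseudoPMetricType R} (K : set X) (g : X -> Z -> E) :
  compact K -> closed K ->
  (forall z, {within K, continuous (g ^~ z)}) ->
  (forall x, K x -> measurable_fun setT (g x : Z -> borel E)) ->
  measurable_fun (K `*` setT : set (borel X * Z)%type)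
    ((fun p => g p.1 p.2) : (borel X * Z)%type -> borel E).
Proof.
move=> Kc Kcl gc gm.
have [->|/set0P[x0 Kx0]] := eqVneq K set0.
  by rewrite set0X; exact: measurable_fun_set0.
have mK : measurable (K `*` setT : set (borel X * Z)%type).
  by apply: measurableX => //; exact: closed_measurable_borel.
have [net [netK netP]] := compact_net Kx0 Kc.
pose B m i := (ball (net m i) m.+1%:R^-1)°.
have Bm m i : measurable (B m i : set (borel X)).
  by apply: open_measurable_borel; exact: open_interior.
apply: (@measurable_fun_borel _ (borel X * Z)%type E) => O oO.
(* Up to interiors, the points at distance at least [1/(l+1)] from the complement of [O]. Being
   closed, this set keeps limits along net points tending to [x]. *)
pose O_ l := ~` \bigcup_(x in ~` O) (ball x l.+1%:R^-1)°.
have Ocl l : closed (O_ l : set E).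
  by apply: open_closedC; apply: bigcup_open => x _; exact: open_interior.
have OO l : O_ l `<=` O.
  move=> x Olx; apply: contrapT => nOx; apply: Olx; exists x => //.
  exact: nbhsx_ballx.
rewrite (_ : _ `&` _ = (K `*` setT) `&` \bigcup_m0 \bigcup_l
    \bigcap_(m in [set m | (m0 <= m)%N]) \bigcap_i
     ((~` B m i) `*` setT `|` setT `*` (g (net m i) @^-1` O_ l))).
  apply: measurableI => //.
  apply: bigcupT_measurable => m0; apply: bigcupT_measurable => l.
  apply: bigcap_measurable => [|m _]; first by exists m0 => /=.
  apply: bigcapT_measurable => i; apply: measurableU; apply: measurableX => //.
    exact: measurableC.
  rewrite -[_ @^-1` _]setTI; apply: gm => //; exact: closed_measurable_borel.
apply/seteqP; split => [[x z] [[/= Kx _] Oxz]|[x z] [[/= Kx _] [m0 _ [l _ H]]]];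
    split => //=; last first.
  have /choice[i iP] : forall m, exists i, B m i x by move=> m; exact: netP.
  apply: (OO l).
  have cv : net m (i m) @[m --> \oo] --> within K (nbhs x).
    move=> A /=; rewrite /within/= => /nbhs_ballP[e /= e0 eA].
    have [m1 _ me] := near_infty_natSinv_lt (PosNum e0).
    exists m1 => // m /= m1m; apply: eA => //; apply: ball_sym.
    apply: le_ball (ltW (me _ m1m)) _ _; exact: interior_subset (iP m).
  have := (proj1 (subspace_continuousP K (g ^~ z)) (gc z)) x Kx.
  move=> gx; have := cvg_comp _ _ cv gx; apply: closed_cvg => //.
  by exists m0 => // m /= m0m; case: (H m m0m (i m) I) => /= -[].
have := oO; rewrite openE => /(_ _ Oxz) /nbhs_ballP[e /= e0 eO].
have [l _ le] := near_infty_natSinv_lt (PosNum (divr_gt0 e0 (ltr0n _ 2))).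
have {}le : l.+1%:R^-1 < e / 2 by exact: (le l (leqnn _)).
have := (proj1 (subspace_continuousP K (g ^~ z)) (gc z)) x Kx.
move=> /(_ _ (nbhsx_ballx _ _ (divr_gt0 e0 (ltr0n _ 2)))) /nbhs_ballP[r /= r0 rP].
have [m0 _ mr] := near_infty_natSinv_lt (PosNum r0).
exists m0 => //; exists l => // m /= m0m i _.
have [xB|] := pselect (B m i x); last by left.
right; split => //= -[y nOy /interior_subset yb]; apply: nOy; apply: eO.
apply: (@ball_split _ _ (g (net m i) z)).
  apply: rP => //; apply: ball_sym; apply: le_ball (ltW (mr _ m0m)) _ _.
  exact: interior_subset xB.
apply: ball_sym; exact: le_ball (ltW le) _ yb.
Qed.


(* Kuratowski--Ryll-Nardzewski: shrink [A t] to a point by intersecting it at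
   stage [m] with the first ball of radius [1/(m+1)] of a net that still meets it. *)
Lemma measurable_selection {d} {T : measurableType d} {X : pmetricType R}
    (D : set T) (A : T -> set X) :
  measurable D -> compact [set: X] ->
  (forall t, D t -> A t !=set0) -> (forall t, D t -> closed (A t)) ->
  (forall C, closed C -> measurable (D `&` [set t | A t `&` C !=set0])) ->
  exists u : T -> X, measurable_fun D (u : T -> borel X) /\
    forall t, D t -> A t (u t).
Proof.
move=> mD Xc Ane Acl Ahit.
have [net [_ netP]] := compact_net (I : [set: X] point) Xc.
pose C m i := closed_ball (net m i) m.+1%:R^-1.
have Ccl m i : closed (C m i) by exact: closed_ball_closed.
pose hit t (S : set X) := A t `&` S !=set0.
(* The first ball of the stage-[m] net that meets what is left of [A t]. The default [0] is not
   reached while something is left, as the net covers the space. *)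
pose idx t m (S : set X) := if pselect (exists i, `[< hit t (S `&` C m i) >])
  is left h then ex_minn h else 0%N.
pose K := fix K t m := if m is m'.+1 then K t m' `&` C m' (idx t m' (K t m'))
  else setT.
have idxP t m : hit t (K t m) -> hit t (K t m `&` C m (idx t m (K t m))) /\
    forall j, (j < idx t m (K t m))%N -> ~ hit t (K t m `&` C m j).
  move=> [x [Ax Kx]]; rewrite /idx; case: pselect => [h|]; last first.
    have [i xi] := netP m x I; case.
    exists i; apply/asboolP; exists x; do 2! split=> //.
    by apply: subset_closed_ball; exact: interior_subset xi.
  case: ex_minnP => i /asboolP hi imin; split => // j ji /asboolP/imin.
  by rewrite leqNgt ji.
have Khit t m : D t -> hit t (K t m).
  move=> Dt; elim: m => [|m /idxP[]//]; have [x Ax] := Ane t Dt; by exists x.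
have Kcl t m : closed (K t m).
  by elim: m => [|m IH] /=; [exact: closedT|exact: closedI].
have Kdec t i j : (i <= j)%N -> K t j `<=` K t i.
  move/subnK => <-; elim: (j - i)%N => [//|k IH] x /= [Kx _]; exact: IH.
pose M m (S : set X) := D `&` [set t | hit t (K t m `&` S)].
have mM m S : closed S -> measurable (M m S).
  elim: m S => [|m IH] S Scl.
    rewrite /M (_ : [set _ | _] = [set t | A t `&` S !=set0]); first exact: Ahit.
    by apply/funext => t; rewrite /hit /= setTI.
  (* Split according to the index [i] picked at stage [m]: ball [i] is met and no earlier ball
     is. *)
  rewrite (_ : M _ _ = \bigcup_i
      ((M m (C m i) `\` \bigcup_(j in [set j | (j < i)%N]) M m (C m j))
      `&` M m (C m i `&` S))).
    apply: bigcupT_measurable => i; apply: measurableI; last by apply: IH; exact: closedI.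
    apply: measurableD; first exact: IH.
    by apply: bigcup_measurable => j _; exact: IH.
  apply/seteqP; split => [t [Dt /= H]|t [i _ [[[Dt hi] nj] [_ hS]]]].
    have [h1 h2] := idxP t m (Khit t m Dt).
    exists (idx t m (K t m)) => //; split; last by split => //=; rewrite setIA.
    by split => // -[j /= ji [_ hj]]; exact: (h2 j ji hj).
  split => //=; have [h1 h2] := idxP t m (Khit t m Dt).
  suff <- : i = idx t m (K t m) by rewrite -setIA.
  apply/eqP; rewrite eqn_leq; apply/andP; split; rewrite leqNgt; apply/negP => lt.
    by apply: nj; exists (idx t m (K t m)).
  exact: h2 i lt hi.
have nested t (S : set X) : closed S -> D t -> (forall m, M m S t) ->
    exists x, forall m, (A t `&` (K t m `&` S)) x.
  move=> Scl Dt MS; apply: compact_nested.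
  - apply: subclosed_compact Xc _ => //.
    by apply: closedI; [exact: Acl|exact: closedI].
  - by move=> i j ij x [Ax [Kx Sx]]; do 2! split=> //; exact: Kdec Kx.
  - by move=> i; apply: closedI; [exact: Acl|exact: closedI].
  - by move=> m; have [_] := MS m.
have /choice[u uP] t : exists x, D t -> forall m, (A t `&` K t m) x.
  have [Dt|nDt] := pselect (D t); last by exists point.
  have [m|x xP] := nested t setT closedT Dt.
    by split => //=; rewrite setIT; exact: Khit.
  by exists x => _ m; have := xP m; rewrite setIT.
exists u; split; last by move=> t /uP/(_ 0%N)[].
apply: measurable_fun_borel_closed => // S Scl.
(* If every stage meets the closed set [S], compactness gives a point of [S] common to all stages;
   as the radii tend to zero, it is [u t]. *)
rewrite (_ : _ `&` _ = \bigcap_m M m S).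
  by apply: bigcapT_measurable => m; exact: mM.
apply/seteqP; split => [t [Dt St] m _|t MS].
  by split => //; exists (u t); have [? ?] := uP t Dt m.
have Dt : D t by have [] := MS 0%N I.
have [m|x xP] := nested t S Scl Dt; first exact: MS.
split => //=; suff -> : u t = x by have [_ []] := xP 0%N.
apply/esym/mdist_positivity/eqP; rewrite eq_le mdist_ge0 andbT.
apply/ler_addgt0Pl => e e0; rewrite addr0.
(* A closed ball of radius below [e / 4] fits into the ball of radius [e / 2], and two points of the
   latter are within [e]. *)
have [m _ me] := near_infty_natSinv_lt (PosNum (divr_gt0 e0 (ltr0n _ 4))).
have {}me : m.+1%:R^-1 < e / 4 by exact: (me m (leqnn _)).
have [_ [[_ Cx] _]] := xP m.+1; have [_ [_ Cu]] := uP t Dt m.+1.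
have sub y : C m (idx t m (K t m)) y -> ball (net m (idx t m (K t m))) (e / 2) y.
  move=> Cy; apply: subset_closure_half; first by rewrite divr_gt0.
  apply: le_closed_ball Cy; apply: le_trans (ltW me) _.
  by rewrite -mulrA -invfM -natrM.
have := ball_splitr (sub _ Cx) (sub _ Cu).
by rewrite ballEmdist /= => /ltW.
Qed.

End borel_measurability.

(** * Integrals and independence *)

Lemma integrable_bounded_measure {d} {T : measurableType d} {R : realType}
    (mu : {measure set T -> \bar R}) (D : set T) (g : T -> R) (M : R) :
  measurable D -> (mu D < +oo)%E -> measurable_fun D g ->
  (forall x, D x -> `|g x| <= M) -> mu.-integrable D (EFin \o g).
Proof.
move=> mD muD mg gM; apply: measurable_bounded_integrable => //.
exists M; split; first exact: num_real.
by move=> y My x Dx /=; apply: le_trans (gM _ Dx) (ltW My).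
Qed.

Lemma integrable_bounded {d} {T : measurableType d} {R : realType}
    (mu : {finite_measure set T -> \bar R}) (D : set T) (g : T -> R) (M : R) :
  measurable D -> measurable_fun D g -> (forall x, D x -> `|g x| <= M) ->
  mu.-integrable D (EFin \o g).
Proof.
move=> mD; apply: integrable_bounded_measure => //.
by rewrite -ge0_fin_numE// fin_num_measure.
Qed.

Lemma Rintegral_bounded {d} {T : measurableType d} {R : realType}
    (P : probability T R) (g : T -> R) (M : R) :
  measurable_fun setT g -> (forall x, `|g x| <= M) -> `|\int[P]_x g x| <= M.
Proof.
move=> mg gM; have gi : P.-integrable setT (EFin \o g).
  exact: (@integrable_bounded _ _ _ _ _ _ M).
apply: le_trans (le_normr_Rintegral measurableT gi) _.
rewrite -[leRHS](mulr1 M) -[X in M * X](_ : fine (P setT) = 1); last first.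
  by rewrite probability_setT.
rewrite -(Rintegral_cst P measurableT M); apply: le_Rintegral => //.
- apply: (@integrable_bounded _ _ _ _ _ _ M) => //; first exact: measurableT_comp.
  by move=> x _; rewrite normr_id.
- exact: (@integrable_bounded _ _ _ _ _ _ `|M|).
Qed.

Lemma Rintegral_prob_cst {d} {T : measurableType d} {R : realType}
    (P : probability T R) (c : R) : \int[P]_x (fun=> c) x = c.
Proof.
rewrite (Rintegral_cst P measurableT c) [X in c * X](_ : _ = 1) ?mulr1//.
by rewrite [X in fine X](_ : _ = 1%E)//; exact: probability_setT.
Qed.

Section bounded_measurable.
Context {d} {T : measurableType d} {R : realType}.
Variables (mu : {finite_measure set T -> \bar R}) (D : set T).
Hypothesis mD : measurable D.

(** For measurable [D], a class stable under linear combinations whose members are integrable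
    against every finite measure; [Rintegral] is linear and monotone on it. *)
Definition bounded_measurable (D : set T) (g : T -> R) :=
  measurable_fun D g /\ exists M, forall x, D x -> `|g x| <= M.

Lemma bounded_measurable_integrable g :
  bounded_measurable D g -> mu.-integrable D (EFin \o g).
Proof. by case=> mg [M gM]; exact: (@integrable_bounded _ _ _ _ _ _ M). Qed.

Lemma bounded_measurable_cst c : bounded_measurable D (cst c).
Proof. by split => //; exists `|c|. Qed.

Lemma bounded_measurableD g h : bounded_measurable D g -> bounded_measurable D h ->
  bounded_measurable D (fun x => g x + h x).
Proof.
move=> [mg [M gM]] [mh [N hN]]; split; first exact: measurable_funD.
exists (M + N) => x Dx; apply: le_trans (ler_normD _ _) _.
by apply: lerD; [exact: gM|exact: hN].
Qed.

Lemma bounded_measurableZ c g : bounded_measurable D g ->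
  bounded_measurable D (fun x => c * g x).
Proof.
move=> [mg [M gM]]; split; first exact: measurable_funM.
by exists (`|c| * M) => x Dx; rewrite normrM ler_wpM2l// gM.
Qed.

Lemma Rintegral_bmD g h : bounded_measurable D g -> bounded_measurable D h ->
  \int[mu]_(x in D) (g x + h x) = \int[mu]_(x in D) g x + \int[mu]_(x in D) h x.
Proof. by move=> bg bh; rewrite RintegralD//; exact: bounded_measurable_integrable. Qed.

Lemma Rintegral_bmZ c g : bounded_measurable D g ->
  \int[mu]_(x in D) (c * g x) = c * \int[mu]_(x in D) g x.
Proof. by move=> bg; rewrite RintegralZl//; exact: bounded_measurable_integrable. Qed.

Lemma bounded_measurableB g h : bounded_measurable D g -> bounded_measurable D h ->
  bounded_measurable D (fun x => g x - h x).
Proof.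
move=> bg bh; have := bounded_measurableD bg (bounded_measurableZ (- 1) bh).
by congr bounded_measurable; apply/funext => x; rewrite mulN1r.
Qed.

Lemma Rintegral_bmB g h : bounded_measurable D g -> bounded_measurable D h ->
  \int[mu]_(x in D) (g x - h x) = \int[mu]_(x in D) g x - \int[mu]_(x in D) h x.
Proof. by move=> bg bh; rewrite RintegralB//; exact: bounded_measurable_integrable. Qed.

Lemma le_Rintegral_bm g h : bounded_measurable D g -> bounded_measurable D h ->
  (forall x, D x -> g x <= h x) ->
  \int[mu]_(x in D) g x <= \int[mu]_(x in D) h x.
Proof. by move=> bg bh gh; apply: le_Rintegral => //; exact: bounded_measurable_integrable. Qed.

Lemma bounded_measurable_sum (g : nat -> T -> R) m :
  (forall i, bounded_measurable D (g i)) ->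
  bounded_measurable D (fun x => \sum_(i < m) g i x).
Proof.
move=> bg; elim: m => [|m IH].
  have := bounded_measurable_cst 0.
  by congr bounded_measurable; apply/funext => x; rewrite big_ord0.
have := bounded_measurableD IH (bg m).
by congr bounded_measurable; apply/funext => x; rewrite big_ord_recr.
Qed.

Lemma Rintegral_bm_sum (g : nat -> T -> R) m :
  (forall i, bounded_measurable D (g i)) ->
  \int[mu]_(x in D) (\sum_(i < m) g i x) = \sum_(i < m) \int[mu]_(x in D) g i x.
Proof.
move=> bg; elim: m => [|m IH].
  rewrite big_ord0 (@eq_Rintegral _ _ _ _ _ (cst 0)) ?Rintegral_cst ?mul0r// => x _.
  by rewrite big_ord0.
rewrite big_ord_recr -IH /= -Rintegral_bmD//; last exact: bounded_measurable_sum.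
by apply: eq_Rintegral => x _; rewrite big_ord_recr.
Qed.

End bounded_measurable.

(** * Independence of the current state from the current sample *)

Section independent_sequence.
Context {R : realType} {d dS} {Om : measurableType d} {S : measurableType dS}.
Variables (P : probability Om R) (s : nat -> Om -> S).
Hypothesis ms : forall t, measurable_fun setT (s t).
Hypothesis s_id : forall t B, measurable B -> P (s t @^-1` B) = P (s 0%N @^-1` B).
Hypothesis s_indep : forall (J : {fset nat}) (B : nat -> set S),
  (forall t, measurable (B t)) ->
  P (\bigcap_(t in [set` J]) (s t @^-1` B t)) = (\prod_(t <- J) P (s t @^-1` B t))%E.

(** Recursive form of the finite intersections in [s_indep], from which the sample at time [t] can
    be split off. *)
Fixpoint future t N (B : nat -> set S) : set Om :=
  if N is N'.+1 then s t @^-1` B t `&` future t.+1 N' B else setT.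

Lemma futureE t N B :
  future t N B = \bigcap_(j in [set` [fset j in iota t N]%fset]) (s j @^-1` B j).
Proof.
elim: N t => [|N IH] t /=.
  by apply/seteqP; split => // w _ j; rewrite /= !inE.
rewrite IH; apply/seteqP; split => [w [Bt BN] j|w BN].
  by rewrite /= !inE => /orP[/eqP ->//|jN]; apply: BN; rewrite /= inE.
split; first by apply: BN; rewrite /= !inE eqxx.
by move=> j; rewrite /= !inE => jN; apply: BN; rewrite /= !inE jN orbT.
Qed.

Lemma measurable_future t N B : (forall t, measurable (B t)) ->
  measurable (future t N B).
Proof.
move=> mB; elim: N t => [|N IH] t /=; first exact: measurableT.
by apply: measurableI => //; rewrite -[_ @^-1` _]setTI; apply: ms.
Qed.

Lemma prob_futureS t N B : (forall t, measurable (B t)) ->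
  P (future t N.+1 B) = (P (s t @^-1` B t) * P (future t.+1 N B))%E.
Proof.
move=> mB; rewrite !futureE !s_indep//.
rewrite (_ : [fset j in iota t N.+1]%fset = t |` [fset j in iota t.+1 N])%fset.
  by rewrite big_fsetU1//= !inE mem_iota ltnn.
by apply/fsetP => j; rewrite !inE.
Qed.

Lemma eq_future t N B B' : (forall j, (t <= j)%N -> B j = B' j) ->
  future t N B = future t N B'.
Proof.
elim: N t => [//|N IH] t BB' /=; rewrite BB'// (IH t.+1)// => j tj.
by apply: BB'; exact: ltnW.
Qed.

Context {dX} {X : measurableType dX}.
Variables (F : nat -> X * S -> X) (x : nat -> Om -> X) (x0 : X).
Hypothesis mF : forall t, measurable_fun setT (F t).
Hypothesis x_0 : forall w, x 0%N w = x0.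
Hypothesis x_S : forall t w, x t.+1 w = F t (x t w, s t w).

Lemma measurable_chain t : measurable_fun setT (x t).
Proof.
elim: t => [|t IH].
  by rewrite (_ : x 0%N = cst x0)//; apply/funext => w; exact: x_0.
rewrite (_ : x t.+1 = F t \o (fun w => (x t w, s t w))).
  by apply: measurableT_comp => //; exact: measurable_fun_pair.
by apply/funext => w; exact: x_S.
Qed.

Let pair t w := (x t w, s t w).

Let mpair t : measurable_fun setT (pair t).
Proof. by apply: measurable_fun_pair => //; exact: measurable_chain. Qed.

(* The future samples stay independent of the current state and of the current
   sample jointly, because this holds on rectangles. *)
Let pair_future t N B (Z : set (X * S)) : (forall t, measurable (B t)) ->
  (forall A N B, measurable A -> (forall t, measurable (B t)) ->
     P (x t @^-1` A `&` future t N B) = (P (x t @^-1` A) * P (future t N B))%E) ->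
  measurable Z ->
  P (pair t @^-1` Z `&` future t.+1 N B) =
  (P (pair t @^-1` Z) * P (future t.+1 N B))%E.
Proof.
move=> mB IH mZ.
have mfut : measurable (future t.+1 N B) by exact: measurable_future.
pose E := future t.+1 N B.
have c0 : 0 <= fine (P E) by exact: fine_ge0.
pose c := NngNum c0.
have cE : (c%:num)%:E = P E by rewrite /= fineK// fin_num_measure.
pose xt : {mfun Om >-> X} :=
  HB.pack (x t) (isMeasurableFun.Build _ _ _ _ (x t) (measurable_chain t)).
pose st : {mfun Om >-> S} := HB.pack (s t) (isMeasurableFun.Build _ _ _ _ (s t) (ms t)).
pose pt : {mfun Om >-> (X * S)%type} :=
  HB.pack (pair t) (isMeasurableFun.Build _ _ _ _ (pair t) (mpair t)).
have rect A C : measurable A -> measurable C ->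
    P (pair t @^-1` (A `*` C) `&` E) = (P (x t @^-1` A) * (P E * P (s t @^-1` C)))%E
    /\ P (pair t @^-1` (A `*` C)) = (P (x t @^-1` A) * P (s t @^-1` C))%E.
  (* [B'] prescribes [C] at time [t], so that the hypothesis on [x t] and the samples from [t] on
     also covers the current sample. *)
  move=> mA mC; pose B' j := if j == t then C else B j.
  have mB' j : measurable (B' j) by rewrite /B'; case: ifP.
  have fB' M : future t.+1 M B' = future t.+1 M B.
    by apply: eq_future => j tj; rewrite /B' gtn_eqF.
  have xE : pair t @^-1` (A `*` C) = x t @^-1` A `&` s t @^-1` C by [].
  split.
    have := IH A N.+1 B' mA mB'; rewrite prob_futureS//= fB' {1 2}/B' eqxx setIA.
    by rewrite -xE => ->; rewrite (muleC (P (s t @^-1` C))).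
  have := IH A 1%N B' mA mB'; rewrite prob_futureS//= {1 2}/B' eqxx setIA setIT.
  by rewrite -xE => ->; rewrite probability_setT mule1.
(* Both [m1] and [m2], the latter being [P E] times the law of the pair, agree on rectangles with a
   product measure; uniqueness of product measures extends the equality to [Z]. *)
have [m1 m1E] : exists m1 : measure (X * S)%type R,
    forall V, m1 V = P (pair t @^-1` V `&` E).
  by unshelve eexists (pushforward (mrestr P mfut) pt); first exact: mpair.
pose m2 : measure (X * S)%type R := mscale c (distribution P pt).
have e1 := @product_measure_unique _ _ _ _ R (distribution P xt)
  (mscale c (distribution P st)) m1.
have e2 := @product_measure_unique _ _ _ _ R (distribution P xt)
  (mscale c (distribution P st)) m2.
have : m1 Z = m2 Z.
  rewrite -e1// => [|A C mA mC]; last first.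
    have [r _] := rect A C mA mC.
    by rewrite m1E r -cE.
  rewrite -e2// => A C mA mC.
  have [_ r] := rect A C mA mC.
  transitivity ((c%:num)%:E * P (pair t @^-1` (A `*` C)))%E; first by [].
  by rewrite r muleCA.
by rewrite m1E => ->; rewrite muleC -/E -cE.
Qed.

(** [x 0%N] is constant and [x t.+1] is a measurable function of the pair at time [t], so
    [pair_future] carries the induction. *)
Let chain_future t A N B : measurable A -> (forall t, measurable (B t)) ->
  P (x t @^-1` A `&` future t N B) = (P (x t @^-1` A) * P (future t N B))%E.
Proof.
elim: t A N B => [|t IH] A N B mA mB.
  have [Ax|Ax] := pselect (A x0).
    rewrite (_ : x 0%N @^-1` A = setT) ?setTI ?probability_setT ?mul1e//.
    by apply/seteqP; split => // w _ /=; rewrite x_0.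
  rewrite (_ : x 0%N @^-1` A = set0) ?set0I ?measure0 ?mul0e//.
  by apply/seteqP; split => // w /=; rewrite x_0.
have -> : x t.+1 @^-1` A = pair t @^-1` (F t @^-1` A).
  by apply/seteqP; split => w; rewrite /= x_S.
apply: pair_future => //.
by rewrite -[_ @^-1` _]setTI; apply: mF.
Qed.

Lemma chain_indep t A C : measurable A -> measurable C ->
  P (x t @^-1` A `&` s t @^-1` C) = (P (x t @^-1` A) * P (s t @^-1` C))%E.
Proof.
move=> mA mC; have := @chain_future t A 1%N (fun=> C) mA (fun=> mC).
by rewrite prob_futureS//= setIT probability_setT mule1.
Qed.

(** The law of [(x t, s t)] is the product of its marginals, [s t] may be replaced by the
    identically distributed [s 0%N], and Fubini integrates over the sample with the state frozen. *)
Lemma chain_fubini t (g : X * S -> R) (M : R) :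
  measurable_fun setT g -> (forall q, `|g q| <= M) ->
  measurable_fun setT (fun y => \int[P]_w g (y, s 0%N w)) /\
  \int[P]_w g (x t w, s t w) = \int[P]_w \int[P]_w' g (x t w, s 0%N w').
Proof.
move=> mg gM.
pose xt : {mfun Om >-> X} :=
  HB.pack (x t) (isMeasurableFun.Build _ _ _ _ (x t) (measurable_chain t)).
pose st : {mfun Om >-> S} := HB.pack (s t) (isMeasurableFun.Build _ _ _ _ (s t) (ms t)).
pose s0 : {mfun Om >-> S} := HB.pack (s 0%N) (isMeasurableFun.Build _ _ _ _ (s 0%N) (ms 0%N)).
pose pt : {mfun Om >-> (X * S)%type} :=
  HB.pack (pair t) (isMeasurableFun.Build _ _ _ _ (pair t) (mpair t)).
have prodE Z : measurable Z ->
    (distribution P xt \x distribution P s0)%E Z = distribution P pt Z.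
  move=> mZ; apply: product_measure_unique => // A C mA mC.
  transitivity (P (x t @^-1` A `&` s t @^-1` C)); first by [].
  by rewrite chain_indep// s_id.
have gi : (distribution P xt \x distribution P s0)%E.-integrable setT (EFin \o g).
  apply: (@integrable_bounded_measure _ _ _ _ _ _ M) => //.
  by rewrite [X in (X < _)%E](_ : _ = 1%E) ?ltry//; exact: probability_setT.
have inner y : (fubini_F (distribution P s0) (EFin \o g) y =
    (\int[P]_w g (y, s 0%N w))%:E)%E.
  have mgy : measurable_fun setT (fun z => g (y, z)).
    by apply: measurableT_comp => //; exact: pair1_measurable.
  have igy : P.-integrable setT (EFin \o (fun w => g (y, s 0%N w))).
    apply: (@integrable_bounded _ _ _ _ _ _ M) => //.
    exact: (measurableT_comp mgy (ms 0%N)).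
  rewrite /fubini_F /distribution integral_pushforward//=.
  - by rewrite preimage_setT /Rintegral fineK//; exact: integrable_fin_num.
  - exact/measurable_EFinP.
have minner : measurable_fun setT (fun y => \int[P]_w g (y, s 0%N w)).
  apply/measurable_EFinP; apply: eq_measurable_fun; last exact: measurable_fubini_F gi.
  by move=> y _ /=; rewrite inner.
split => //.
rewrite /Rintegral; congr fine.
transitivity (\int[distribution P pt]_q (g q)%:E)%E.
  rewrite integral_pushforward//=; first exact/measurable_EFinP.
  apply: (@integrable_bounded _ _ _ _ _ _ M) => //.
    by rewrite preimage_setT.
  by rewrite preimage_setT; exact: (measurableT_comp mg (mpair t)).
transitivity (\int[(distribution P xt \x distribution P s0)%E]_q (g q)%:E)%E.
  by apply: eq_measure_integral => Z mZ _; exact/esym/prodE.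
rewrite -integral12_prod_meas1//.
transitivity (\int[distribution P xt]_y (\int[P]_w g (y, s 0%N w))%:E)%E.
  by apply: eq_integral => y _; exact: inner.
rewrite integral_pushforward//= ?preimage_setT//.
  exact: measurable_chain.
  exact/measurable_EFinP.
apply: (@integrable_bounded _ _ _ _ _ _ M) => //.
  exact: (measurableT_comp minner (measurable_chain t)).
move=> w _ /=; apply: Rintegral_bounded => //.
apply: measurableT_comp => //; apply: measurable_fun_pair => //; exact: ms.
Qed.

End independent_sequence.

(** * Semicontinuity *)

Lemma cvg_Rintegral_bounded {d} {T : measurableType d} {R : realType}
    (mu : {finite_measure set T -> \bar R}) (D : set T) (g_ : nat -> T -> R)
    (g : T -> R) (M : R) :
  measurable D -> (forall i, measurable_fun D (g_ i)) ->
  (forall i x, D x -> `|g_ i x| <= M) ->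
  (forall x, D x -> g_ i x @[i --> \oo] --> g x) ->
  \int[mu]_(x in D) g_ i x @[i --> \oo] --> \int[mu]_(x in D) g x.
Proof.
move=> mD mg gM gc.
have mgl : measurable_fun D g by exact: measurable_fun_cvg gc.
have gMl x : D x -> `|g x| <= M.
  move=> Dx; apply: (@closed_cvg _ _ \oo _ (g_ ^~ x) [set y | `|y| <= M]).
  - apply: (@preimage_closed _ _ (fun y : R => `|y|) [set y | y <= M]).
      by move=> y _; exact: norm_continuous.
    exact: closed_le.
  - by apply: nearW => i; exact: gM.
  - exact: gc.
have gi : mu.-integrable D (EFin \o g) by exact: (@integrable_bounded _ _ _ _ _ _ M).
have := @dominated_cvg _ _ _ mu D mD (fun i x => (g_ i x)%:E) (EFin \o g) (cst M%:E).
move=> H; apply: fine_cvg; rewrite fineK ?integrable_fin_num//; apply: H => //.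
- by move=> i; exact/measurable_EFinP.
- by move=> x Dx; apply: cvg_EFin; [exact: nearW|exact: gc].
- apply: (@integrable_bounded _ _ _ _ _ (cst M) `|M|) => //.
Qed.

Section semicontinuity.
Context {R : realType}.

Lemma within_continuous_seq {X : pseudoMetricType R} (K : set X) (g : X -> R) :
  (forall (p : nat -> X) x, (forall i, K (p i)) -> K x -> p i @[i --> \oo] --> x ->
     g (p i) @[i --> \oo] --> g x) ->
  {within K, continuous g}.
Proof.
move=> gseq; apply/subspace_continuousP => x Kx; apply/cvgrPdist_lt => e e0.
apply: contrapT => nA.
have /choice[p pP] : forall i, exists y, [/\ K y, ball x i.+1%:R^-1 y & ~ `|g x - g y| < e].
  move=> i; apply: contrapT => nE; apply: nA; rewrite /within/=.
  apply/nbhs_ballP; exists i.+1%:R^-1 => //= y xy Ky.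
  by apply: contrapT => ne; apply: nE; exists y.
have /cvgrPdist_lt/(_ e e0)[N _ /(_ N (leqnn N))] :
  g (p i) @[i --> \oo] --> g x; last by case: (pP N).
apply: gseq => // [i|]; first by case: (pP i).
move=> B /nbhs_ballP[r /= r0 rB].
have [m _ mr] := near_infty_natSinv_lt (PosNum r0).
exists m => // i /= mi; apply: rB; have [_ xp _] := pP i.
by apply: le_ball xp; exact: ltW (mr i mi).
Qed.

Lemma within_continuous_Rintegral {d} {Om : measurableType d}
    (P : probability Om R) {X : pseudoMetricType R} (K : set X)
    (g : X -> Om -> R) (M : R) :
  (forall w, {within K, continuous (g ^~ w)}) ->
  (forall x, K x -> measurable_fun setT (g x)) ->
  (forall x w, K x -> `|g x w| <= M) ->
  {within K, continuous (fun x => \int[P]_w g x w)}.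
Proof.
move=> gc mg gM; apply: within_continuous_seq => p x Kp Kx px.
apply: (@cvg_Rintegral_bounded _ _ _ P setT (fun i => g (p i)) (g x) M) => //.
- by move=> i; exact: mg.
- by move=> i w _; exact: gM.
- move=> w _.
  have := (proj1 (subspace_continuousP K (g ^~ w)) (gc w)) x Kx.
  move=> /(_ _); apply: cvg_comp => A /= /px [N _ NA]; exists N => // i /= Ni.
  exact: NA.
Qed.

(** Closedness is meant in the whole space; for closed [Y] this is lower semicontinuity relative to
    [Y]. *)
Definition lsc_on {X : topologicalType} (Y : set X) (g : X -> R) :=
  forall c, closed (Y `&` [set x | g x <= c]).

(* Approximation from below by the inf-convolutions
   [x |-> inf_(y in Y) (g y + j * |x - y|)]. *)
Lemma lsc_approx {V : pseudoMetricNormedZmodType R} (Y : set V) (g : V -> R) (B : R) :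
  Y !=set0 -> (forall y, Y y -> `|g y| <= B) -> lsc_on Y g ->
  exists phi : nat -> V -> R,
   [/\ forall j, continuous (phi j),
       forall j y, Y y -> `|phi j y| <= B,
       forall j y, Y y -> phi j y <= g y &
       forall y, Y y -> phi j y @[j --> \oo] --> g y].
Proof.
move=> [y0 Yy0] gB gl.
pose A j x := [set g y + j%:R * `|x - y| | y in Y].
pose phi j x := inf (A j x).
have Ane j x : A j x !=set0 by exists (g y0 + j%:R * `|x - y0|), y0.
have Alb j x : lbound (A j x) (- B).
  move=> _ [y Yy <-]; apply: le_trans (_ : g y <= _).
    by have := gB y Yy; rewrite ler_norml => /andP[].
  by rewrite lerDl mulr_ge0.
have Ahlb j x : has_lbound (A j x) by exists (- B).
have phi_le j x y : Y y -> phi j x <= g y + j%:R * `|x - y|.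
  by move=> Yy; apply: ge_inf => //; exists y.
have phi_ge j x : - B <= phi j x by apply: lb_le_inf.
have phi_g j y : Y y -> phi j y <= g y.
  by move=> Yy; have := phi_le j y y Yy; rewrite subrr normr0 mulr0 addr0.
have lip j x x' : phi j x <= phi j x' + j%:R * `|x - x'|.
  rewrite -lerBlDr; apply: lb_le_inf => // _ [y Yy <-].
  rewrite lerBlDr; apply: le_trans (phi_le j x y Yy) _.
  rewrite -addrA lerD2l -mulrDr ler_wpM2l// [leRHS]addrC.
  exact: ler_distD.
have lipn j x x' : `|phi j x - phi j x'| <= j%:R * `|x - x'|.
  rewrite ler_norml lerBlDl lip andbT lerNl opprB lerBlDl.
  by rewrite distrC lip.
exists phi; split => //.
- move=> j x; apply/cvgrPdist_lt => e e0.
  have d0 : 0 < e / j.+1%:R by rewrite divr_gt0.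
  near=> x'; apply: le_lt_trans (lipn _ _ _) _.
  have : ball x (e / j.+1%:R) x' by near: x'; exact: nbhsx_ballx.
  rewrite -ball_normE /= ltr_pdivlMr// mulrC => h; apply: le_lt_trans h.
  by rewrite ler_wpM2r// ler_nat.
- move=> j y Yy; rewrite ler_norml phi_ge/=; apply: le_trans (phi_g j y Yy) _.
  by have := gB y Yy; rewrite ler_norml => /andP[].
- move=> y Yy; apply/cvgrPdist_lt => e e0.
  have yC : (~` (Y `&` [set x | g x <= g y - e / 2])) y.
    by move=> [_ /=]; rewrite lerBrDr gerDl leNgt divr_gt0.
  have := closed_openC (gl (g y - e / 2)); rewrite openE => /(_ _ yC).
  move=> /nbhs_ballP[r /= r0 rP].
  near=> j.
  rewrite ger0_norm ?subr_ge0 ?phi_g// ltrBlDr -ltrBlDl.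
  apply: (@lt_le_trans _ _ (g y - e / 2)).
    by rewrite ltrD2l ltrN2 ltr_pdivrMr// mulr_natr mulr2n ltrDl.
  apply: lb_le_inf => // _ [x Yx <-].
  (* Near [y], lower semicontinuity bounds [g x] from below; at distance [r] or more, the penalty
     [j%:R * r] is at least [2 B] once [j] is large. *)
  have [xr|rx] := ltP `|y - x| r.
    have /not_andP[//|/negP] := rP x ltac:(by rewrite -ball_normE).
    rewrite -ltNge => /ltW h; apply: le_trans h _.
    by rewrite lerDl mulr_ge0.
  apply: (@le_trans _ _ (- B + j%:R * r)); last first.
    apply: lerD; last by rewrite ler_wpM2l.
    by have := gB x Yx; rewrite ler_norml => /andP[].
  apply: (@le_trans _ _ B).
    apply: (@le_trans _ _ (g y)); first by rewrite gerBl divr_ge0// ltW.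
    by have := gB y Yy; rewrite ler_norml => /andP[].
  rewrite -lerBlDl opprK -ler_pdivrMr//; near: j.
  exact: nbhs_infty_ger.
Unshelve. all: by end_near. Qed.

End semicontinuity.

(** * The control model *)

Lemma within_comp_continuous {X Z W : topologicalType} (K : set X) (g : X -> Z)
    (phi : Z -> W) :
  {within K, continuous g} -> continuous phi -> {within K, continuous (phi \o g)}.
Proof.
move=> gc phic x; apply: (@continuous_comp (subspace K) Z W); first exact: gc.
exact: phic.
Qed.

Lemma lsc_measurable {R : realType} {X : ptopologicalType} (K : set X) (g : X -> R) :
  closed K -> lsc_on K g -> measurable_fun (K : set (borel X)) (g : borel X -> R).
Proof.
move=> Kcl gl; apply: measurable_fun_borelR.
  exact: closed_measurable_borel.
by move=> c; apply: closed_measurable_borel; exact: gl.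
Qed.

Lemma within_continuous_lsc {R : realType} {X : topologicalType} (K : set X)
    (g : X -> R) :
  closed K -> {within K, continuous g} -> lsc_on K g.
Proof. by move=> Kcl gc c; exact: (closed_within_preimage Kcl gc (@closed_le _ c)). Qed.

Lemma within_continuous_measurable {R : realType} {X : ptopologicalType}
    (K : set X) (g : X -> R) : closed K -> {within K, continuous g} ->
  measurable_fun (K : set (borel X)) (g : borel X -> R).
Proof. by move=> Kcl gc; apply: lsc_measurable => //; exact: within_continuous_lsc. Qed.

(** The hypotheses make [g] the supremum of the [g_ j] on [K], so its sublevel sets are
    intersections of theirs. *)
Lemma lsc_on_limit {R : realType} {X : topologicalType} (K : set X)
    (g_ : nat -> X -> R) (g : X -> R) :
  closed K -> (forall j, {within K, continuous (g_ j)}) ->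
  (forall j x, K x -> g_ j x <= g x) ->
  (forall x, K x -> g_ j x @[j --> \oo] --> g x) -> lsc_on K g.
Proof.
move=> Kcl gc g_le g_cvg c.
rewrite (_ : _ `&` _ = \bigcap_j (K `&` [set x | g_ j x <= c])).
  by apply: closed_bigI => j _; exact: within_continuous_lsc.
apply/seteqP; split => [x [Kx /= gx] j _|x H].
  by split => //=; apply: le_trans gx; exact: g_le.
have Kx : K x by case: (H 0%N I).
split => //; apply: (@closed_cvg _ _ \oo _ (g_ ^~ x) [set z | z <= c] (@closed_le _ c)).
  by apply: nearW => j; case: (H j I).
exact: g_cvg.
Qed.

Lemma measurable_fun_pair_on {d d1 d2} {T : measurableType d}
    {T1 : measurableType d1} {T2 : measurableType d2} (D : set T)
    (g1 : T -> T1) (g2 : T -> T2) :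
  measurable_fun D g1 -> measurable_fun D g2 ->
  measurable_fun D (fun x => (g1 x, g2 x)).
Proof.
move=> m1 m2 mD.
apply: (measurability _ (measurable_prod_measurableType T1 T2)) => //.
move=> _ [_ [A mA [B mB <-]] <-].
rewrite (_ : _ `&` _ = (D `&` g1 @^-1` A) `&` (D `&` g2 @^-1` B)).
  by apply: measurableI; [exact: m1|exact: m2].
by apply/seteqP; split => [x [Dx []]//|x [[Dx Ax] [_ Bx]]].
Qed.

Section model.
Context {R : realType} {n : nat} {Uhat : pmetricType R} {S : ptopologicalType}.
Context {d : measure_display} {Om : measurableType d}.
Variables (P : probability Om R) (s : nat -> Om -> S).
Variables (Y : set 'rV[R]_n) (f : 'rV[R]_n -> Uhat -> S -> 'rV[R]_n).
Variables (U : 'rV[R]_n -> set Uhat) (k : 'rV[R]_n -> Uhat -> R).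
Hypotheses (Y_compact : compact Y) (Uhat_compact : compact [set: Uhat]).
Hypothesis f_continuous : forall z, {within Y `*` [set: Uhat],
  continuous (fun p : 'rV[R]_n * Uhat => f p.1 p.2 z)}.
Hypothesis f_measurable : forall y u, Y y ->
  measurable_fun [set: borel S] (f y u : borel S -> borel 'rV[R]_n).
Hypothesis s_iid : iid P s.
Hypothesis U_usc : upper_semicontinuous Y U.
Hypothesis U_nonempty : forall y, Y y -> U y !=set0.
Hypothesis U_compact : forall y, Y y -> compact (U y).
Hypothesis f_invariant : forall y u z, Y y -> U y u -> Y (f y u z).
Hypothesis k_continuous : {within Y `*` [set: Uhat],
  continuous (fun p : 'rV[R]_n * Uhat => k p.1 p.2)}.

Local Notation rV := 'rV[R]_n.
Local Notation YU := (Y `*` [set: Uhat]).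
Local Notation gr := (G Y U).

Definition bounded_on (phi : rV -> R) (B : R) := forall y, Y y -> `|phi y| <= B.

Lemma closedY : closed Y.
Proof. exact: (compact_closed (@norm_hausdorff _ _) Y_compact). Qed.

Lemma measurableY : measurable (Y : set (borel rV)).
Proof. by apply: closed_measurable_borel; exact: closedY. Qed.

Lemma compactYU : compact YU.
Proof. exact: compact_setX. Qed.

Lemma closedYU : closed YU.
Proof.
rewrite (_ : YU = fst @^-1` Y).
  by apply: preimage_closed; [move=> p _; exact: cvg_fst|exact: closedY].
by apply/seteqP; split => [p []|p Yp].
Qed.

Lemma k_bounded : exists C : R, forall y u, Y y -> `|k y u| <= C.
Proof.
have /compact_bounded[C [_ CP]] := continuous_compact k_continuous compactYU.
exists (C + 1) => y u Yy; apply: (CP (C + 1)); first by rewrite ltrDl.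
by exists (y, u).
Qed.

Lemma subset_G_YU : (gr : set (rV * Uhat)) `<=` YU.
Proof. by move=> p [Yp _]; split. Qed.

(** If [u] is outside [U y], the complement of a small closed ball around [u] is an open set
    containing [U y], hence also [U y'] for [y'] in [Y] near [y]. *)
Lemma closedG : closed (gr : set (rV * Uhat)).
Proof.
rewrite -[gr : set (rV * Uhat)%type]setCK; apply: open_closedC.
rewrite openE => -[y u] nG.
have [Yy|nYy] := pselect (Y y); last first.
  have : open (~` YU) by apply: closed_openC; exact: closedYU.
  rewrite openE => /(_ (y, u) _)[|]; first by case.
  move=> B [/= B1 B2] sub; exists B => //= p /sub np [Yp _]; apply: np; by split.
have nU : ~ U y u by move=> Uyu; apply: nG; split.
have /closed_openC := compact_closed (@metric_hausdorff _ Uhat) (U_compact Yy).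
rewrite openE => /(_ u nU) /nbhs_ballP[e /= e0 eU].
pose Vo := ~` closed_ball u (e / 2).
have Vopen : open Vo by apply: closed_openC; exact: closed_ball_closed.
have UV : U y `<=` Vo.
  by move=> v Uv /(subset_closure_half e0) /eU; exact.
have nearU := U_usc Yy Vopen UV.
exists ([set y' | Y y' -> U y' `<=` Vo], ball u (e / 2)).
  by split => /=; [exact: nearU|apply: nbhsx_ballx; rewrite divr_gt0].
move=> [y' u'] [/= h bu] [/= Yy' Uu']; apply: (h Yy' u' Uu').
exact: subset_closed_ball.
Qed.

Lemma compactG : compact (gr : set (rV * Uhat)).
Proof.
exact: (subclosed_compact closedG compactYU subset_G_YU).
Qed.

Lemma measurableG : measurable gr.
Proof. apply: closed_measurable_borel; exact: closedG. Qed.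

Lemma ms t : measurable_fun setT (s t : Om -> borel S).
Proof. by case: s_iid. Qed.

Lemma measurable_next phi y u : measurable_fun (Y : set (borel rV)) (phi : borel rV -> R) ->
  gr (y, u) -> measurable_fun setT (fun w => phi (f y u (s 0%N w))).
Proof.
move=> mphi [/= Yy Uyu].
apply: (@measurable_comp _ _ _ _ (borel rV) _ Y phi setT
  (fun w => f y u (s 0%N w) : borel rV)) => //.
- exact: measurableY.
- by move=> _ [w _ <-]; exact: f_invariant.
- exact: (measurableT_comp (f_measurable u Yy) (ms 0)).
Qed.

Lemma Enext_bounded phi B y u :
  measurable_fun (Y : set (borel rV)) (phi : borel rV -> R) -> bounded_on phi B ->
  gr (y, u) -> `|Enext P s f phi y u| <= B.
Proof.
move=> mphi phiB yu; apply: Rintegral_bounded; first exact: measurable_next.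
by move=> w; apply: phiB; apply: f_invariant; case: yu.
Qed.

(** * Trajectories under a fixed plan *)

Section plan.
Variable pi : nat -> rV -> Uhat.
Hypothesis pi_plan : plan Y U pi.
Variable y0 : rV.
Hypothesis Yy0 : Y y0.
Local Notation X := (state s f pi y0).
Local Notation A := (control s f pi y0).

Lemma state_in t w : Y (X t w).
Proof.
by elim: t => [//|t IH] /=; apply: f_invariant => //; case: (pi_plan t) => _; exact.
Qed.

Lemma state_control_in t w : gr (X t w, A t w).
Proof.
by split=> /=; [exact: state_in|case: (pi_plan t) => _; apply; exact: state_in].
Qed.

(** The closed-loop transition, extended by [y0] off [Y]: it becomes measurable on the whole
    product, as the chain lemmas require, and keeps its values in [Y]. *)
Let F t (q : borel rV * borel S) : borel rV :=
  if q.1 \in Y then f q.1 (pi t q.1) q.2 else y0.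

Lemma measurable_pair_pi t :
  measurable_fun (Y : set (borel rV))
    ((fun y => (y, pi t y)) : borel rV -> borel (rV * Uhat)%type).
Proof.
apply: (@measurable_fun_pair_borel _ _ (borel rV) rV Uhat Y setT) => //.
- exact: measurableY.
- by case: (pi_plan t).
Qed.

Let F_in t q : Y (F t q).
Proof.
rewrite /F; case: ifPn => // /set_mem Yq; apply: f_invariant => //.
by case: (pi_plan t) => _; exact.
Qed.

Let mF t : measurable_fun setT (F t).
Proof.
rewrite /F; apply: measurable_fun_if => //.
- apply: (measurable_fun_bool true); rewrite setTI.
  rewrite (_ : _ @^-1` _ = Y `*` setT).
    by apply: measurableX => //; exact: measurableY.
  by apply/seteqP; split => [q /= /set_mem|q [/= Yq _]]; [|exact: mem_set].
- rewrite setTI (_ : _ @^-1` _ = Y `*` setT); last first.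
    by apply/seteqP; split => [q /= /set_mem|q [/= Yq _]]; [|exact: mem_set].
  (* [f] is continuous in the pair [(y, u)] and measurable in the sample, hence jointly measurable
     on [YU]. Composing with the graph map of [pi t] gives the closed loop, although [pi t] is only
     Borel. *)
  have mf := @caratheodory_measurable R _ (borel S) (rV * Uhat)%type rV YU
    (fun p z => f p.1 p.2 z) compactYU closedYU f_continuous
    (fun p Kp => f_measurable p.2 Kp.1).
  apply: (@measurable_comp _ _ _ _ _ _ _ _ _
    (fun q : borel rV * borel S => ((q.1, pi t q.1) : borel (rV * Uhat)%type, q.2)) _ _ mf).
  + by apply: measurableX => //; apply: closed_measurable_borel; exact: closedYU.
  + by move=> _ [q [Yq _] <-].
  + apply: measurable_fun_pair_on; last exact: measurable_funTS measurable_snd.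
    apply: (measurable_comp measurableY _ (measurable_pair_pi t)).
      by move=> _ [q [Yq _] <-].
    exact: measurable_funTS measurable_fst.
Qed.

Let state_F t w : X t.+1 w = F t (X t w, s t w).
Proof. by rewrite /F /= mem_set//; exact: state_in. Qed.

Lemma measurable_state t : measurable_fun setT (X t : Om -> borel rV).
Proof.
exact: (@measurable_chain _ _ _ (borel S) s ms _ (borel rV) F X y0 mF (fun=> erefl) state_F).
Qed.

Lemma measurable_on_state phi t :
  measurable_fun (Y : set (borel rV)) (phi : borel rV -> R) ->
  measurable_fun setT (fun w => phi (X t w)).
Proof.
move=> mphi; apply: (measurable_comp measurableY _ mphi (measurable_state t)).
by move=> _ [w _ <-]; exact: state_in.
Qed.

(** One-step tower property: [chain_fubini], applied to [phi] after [F t], averages over the sample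
    with the state frozen. *)
Lemma Enext_state phi B t :
  measurable_fun (Y : set (borel rV)) (phi : borel rV -> R) -> bounded_on phi B ->
  measurable_fun setT (fun w => Enext P s f phi (X t w) (A t w)) /\
  \int[P]_w phi (X t.+1 w) = \int[P]_w Enext P s f phi (X t w) (A t w).
Proof.
move=> mphi phiB; have [_ s_id s_ind] := s_iid.
have mg : measurable_fun setT (fun q => phi (F t q)).
  apply: (measurable_comp measurableY _ mphi (mF t)).
  by move=> _ [q _ <-]; exact: F_in.
have [mE eE] := @chain_fubini _ _ _ _ (borel S) P s ms s_id s_ind _ (borel rV) F X y0
  mF (fun=> erefl) state_F t _ _ mg (fun q => phiB _ (F_in t q)).
have EE w : \int[P]_w' phi (F t (X t w, s 0%N w')) = Enext P s f phi (X t w) (A t w).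
  by rewrite /Enext /F /= mem_set//; exact: state_in.
split.
  rewrite -[X in measurable_fun _ X](_ : (fun w => \int[P]_w' phi (F t (X t w, s 0%N w'))) = _).
    exact: (measurableT_comp mE (measurable_state t)).
  by apply/funext => w; exact: EE.
under eq_Rintegral do rewrite state_F.
rewrite eE; apply: eq_Rintegral => w _; exact: EE.
Qed.

Lemma measurable_cost t : measurable_fun setT (stage_cost s f k pi y0 t).
Proof.
apply: (@measurable_on_state (fun y => k y (pi t y))).
have mk := within_continuous_measurable closedYU k_continuous.
apply: (measurable_comp _ _ mk (measurable_pair_pi t)).
  by apply: closed_measurable_borel; exact: closedYU.
by move=> _ [y Yy <-].
Qed.


Lemma bounded_cost t : bounded_measurable setT (stage_cost s f k pi y0 t).
Proof.
split; first exact: measurable_cost.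
have [C kC] := k_bounded; exists C => w _; apply: kC; exact: state_in.
Qed.

Lemma bounded_state phi B t :
  measurable_fun (Y : set (borel rV)) (phi : borel rV -> R) -> bounded_on phi B ->
  bounded_measurable setT (fun w => phi (X t w)).
Proof.
move=> mphi phiB; split; first exact: measurable_on_state.
by exists B => w _; apply: phiB; exact: state_in.
Qed.

Lemma bounded_Enext_state phi B t :
  measurable_fun (Y : set (borel rV)) (phi : borel rV -> R) -> bounded_on phi B ->
  bounded_measurable setT (fun w => Enext P s f phi (X t w) (A t w)).
Proof.
move=> mphi phiB; split; first by case: (Enext_state t mphi phiB).
by exists B => w _; apply: Enext_bounded => //; exact: state_control_in.
Qed.

Definition mean_cost t := \int[P]_w stage_cost s f k pi y0 t w.

(** Weak duality along one plan. The constant [M *+ 2] bounds the boundary terms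
    [alpha ^+ m * e m - e 0%N] together with the summation remainder [M * (1 - alpha ^+ m)]. *)
Lemma mean_cost_dual alpha mu psi eta M m : 0 <= alpha <= 1 ->
  dual_feasible P s Y f U k y0 mu psi eta -> bounded_on eta M ->
  mu * (\sum_(t < m) alpha ^+ t) <= \sum_(t < m) alpha ^+ t * mean_cost t + M *+ 2.
Proof.
move=> /andP[a0 a1] [[mpsi [Bp psiB]] [meta _] feas] etaM.
pose e t := \int[P]_w eta (X t w).
pose p t := \int[P]_w psi (X t w).
have bpsi t : bounded_measurable setT (fun w => psi (X t w)) by exact: bounded_state psiB.
have beta t : bounded_measurable setT (fun w => eta (X t w)) by exact: bounded_state etaM.
have bcst (c : R) : bounded_measurable setT (fun _ : Om => c) by exact: bounded_measurable_cst.
have int_cst c : \int[P]_w (fun _ : Om => c) w = c by exact: Rintegral_prob_cst.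
have p_ge t : psi y0 <= p t.
  elim: t => [|t IH]; first by rewrite /p /= int_cst.
  apply: le_trans IH _; rewrite /p (Enext_state t mpsi psiB).2.
  apply: le_Rintegral_bm => //; first exact: bounded_Enext_state psiB.
  move=> w _; have [Yx Ux] := state_control_in t w.
  by have [_] := feas _ _ Yx Ux; rewrite subr_ge0.
have e_le t : `|e t| <= M.
  apply: Rintegral_bounded; first by case: (beta t).
  by move=> w; apply: etaM; exact: state_in.
have step t : mu + e t <= mean_cost t + e t.+1.
  (* Since [p t] is at least [psi y0], these two terms may be inserted; the result is the
     expectation of the first dual constraint. *)
  suff : mu + p t + e t <= mean_cost t + (psi y0 + e t.+1) by have := p_ge t; lra.
  have bE := bounded_Enext_state t meta etaM.
  have bc := bounded_cost t.
  have b1 := bounded_measurableD (bcst mu) (bpsi t).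
  have b2 := bounded_measurableD (bcst (psi y0)) bE.
  have -> : mu + p t + e t = \int[P]_w (mu + psi (X t w) + eta (X t w)).
    by rewrite Rintegral_bmD// Rintegral_bmD// int_cst.
  have -> : mean_cost t + (psi y0 + e t.+1) = \int[P]_w (stage_cost s f k pi y0 t w +
      (psi y0 + Enext P s f eta (X t w) (A t w))).
    by rewrite Rintegral_bmD// Rintegral_bmD// int_cst /e (Enext_state t meta etaM).2.
  apply: le_Rintegral_bm => //; [exact: bounded_measurableD|exact: bounded_measurableD|].
  move=> w _; have [Yx Ux] := state_control_in t w.
  have [+ _] := feas _ _ Yx Ux; rewrite /stage_cost /=; lra.
(* Invariant of the Abel summation: [M * (1 - alpha ^+ m)] dominates the sum of the
   remainders [(alpha ^+ t - alpha ^+ t.+1) * e t.+1]. *)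
have telescope : mu * (\sum_(t < m) alpha ^+ t) <=
    \sum_(t < m) alpha ^+ t * mean_cost t + (alpha ^+ m * e m - e 0%N + M * (1 - alpha ^+ m)).
  elim: m => [|m IH]; first by rewrite !big_ord0 expr0; lra.
  rewrite !big_ord_recr /= mulrDr exprS.
  have am : 0 <= alpha ^+ m by exact: exprn_ge0.
  have h1 := ler_wpM2l am (step m).
  have h2 : 0 <= (alpha ^+ m * (1 - alpha)) * (M - e m.+1).
    have := e_le m.+1; rewrite ler_norml => /andP[_ eM].
    by rewrite mulr_ge0 ?mulr_ge0 ?subr_ge0.
  lra.
apply: le_trans telescope _; rewrite lerD2l mulr2n.
have /ler_wpM2l/(_ _ _ (le_trans (ler_norm _) (e_le m))) : 0 <= alpha ^+ m by exact: exprn_ge0.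
have := e_le 0%N; rewrite ler_norml => /andP[+ _]; lra.
Qed.


Lemma cost_mean m :
  \int[P]_w \sum_(t < m) stage_cost s f k pi y0 t w = \sum_(t < m) mean_cost t.
Proof. by rewrite (@Rintegral_bm_sum _ _ _ P)//; exact: bounded_cost. Qed.

(** * Discounted cost over an infinite horizon *)

Section discounted.
Variables (alpha C : R).
Hypotheses (alpha_ge0 : 0 <= alpha) (alpha_lt1 : alpha < 1).
Hypothesis kC : forall y u, Y y -> `|k y u| <= C.

Let discounted_cost w t := alpha ^+ t * stage_cost s f k pi y0 t w.

Definition total_cost := \int[P]_w limn (series (discounted_cost w)).

Let discounted_le w t : `|discounted_cost w t| <= C * alpha ^+ t.
Proof.
rewrite normrM ger0_norm ?exprn_ge0// mulrC; apply: ler_wpM2r; first exact: exprn_ge0.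
apply: kC; exact: state_in.
Qed.

Let C_ge0 : 0 <= C.
Proof. exact: le_trans (normr_ge0 _) (kC point Yy0). Qed.

Let series_cvg w : cvgn (series (discounted_cost w)).
Proof.
apply: normed_cvg; apply: (@series_le_cvg _ _ (geometric C alpha)).
- by move=> t; exact: normr_ge0.
- by move=> t; rewrite /geometric /= mulr_ge0 ?exprn_ge0.
- by move=> t; rewrite /geometric /=; exact: discounted_le.
- by apply: is_cvg_geometric_series; rewrite ger0_norm.
Qed.

(** Series and expectation are interchanged by dominated convergence, the partial sums being bounded
    by [C / (1 - alpha)]. *)
Lemma total_cost_cvg :
  \sum_(t < m) alpha ^+ t * mean_cost t @[m --> \oo] --> total_cost.
Proof.
have bt t : bounded_measurable setT (discounted_cost ^~ t).
  exact: (bounded_measurableZ _ (bounded_cost t)).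
have e m : \sum_(t < m) alpha ^+ t * mean_cost t =
    \int[P]_w \sum_(t < m) discounted_cost w t.
  rewrite (@Rintegral_bm_sum _ _ _ P _ _ (fun t w => discounted_cost w t))//.
  by apply: eq_bigr => t _; rewrite -Rintegral_bmZ//; exact: bounded_cost.
under eq_cvg do rewrite e.
apply: (@cvg_Rintegral_bounded _ _ _ P setT _ _ (C / (1 - alpha))) => //.
- by move=> m; case: (bounded_measurable_sum m bt).
- move=> m w _; apply: le_trans (ler_norm_sum _ _ _) _.
  apply: (@le_trans _ _ (\sum_(t < m) C * alpha ^+ t)).
    by apply: ler_sum => t _; exact: discounted_le.
  rewrite -big_distrr /=; apply: ler_wpM2l => //.
  rewrite -[leRHS]mul1r ler_pdivlMr ?subr_gt0//.
  have := subrX1 alpha m; have : 0 <= alpha ^+ m by exact: exprn_ge0.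
  by set Sm := \sum_(t < m) _; lra.
- move=> w _; rewrite (_ : (fun i => _) = series (discounted_cost w)).
    exact: series_cvg.
  by apply/funext => m; rewrite /series /= big_mkord.
Qed.

(** Costs from time [m] on add up to at most a geometric tail. Multiplication by [1 - alpha] avoids
    a division and matches the factor [eps] of [h]. *)
Lemma total_cost_tail m :
  total_cost * (1 - alpha) <=
  (\sum_(t < m) alpha ^+ t * mean_cost t) * (1 - alpha) + C * alpha ^+ m.
Proof.
have mc t : mean_cost t <= C.
  apply: le_trans (ler_norm _) _; apply: Rintegral_bounded; first exact: measurable_cost.
  by move=> w; apply: kC; exact: state_in.
have cv : (\sum_(t < j) alpha ^+ t * mean_cost t) * (1 - alpha) @[j --> \oo] -->
    total_cost * (1 - alpha) by apply: cvgMr_tmp; exact: total_cost_cvg.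
apply: (@closed_cvg _ _ \oo _ _ [set x | x <= _] (@closed_le _ _) _ _ cv).
exists m => // j /= /subnK <-.
suff claim i : (\sum_(t < i + m) alpha ^+ t * mean_cost t) * (1 - alpha) <=
    (\sum_(t < m) alpha ^+ t * mean_cost t) * (1 - alpha) +
    C * (alpha ^+ m - alpha ^+ (i + m)).
  apply: le_trans (claim _) _; rewrite lerD2l; apply: ler_wpM2l => //.
  by rewrite gerBl exprn_ge0.
elim: i => [|i IH]; first by rewrite add0n subrr mulr0 addr0.
rewrite addSn big_ord_recr /= mulrDl exprS.
have am : 0 <= (1 - alpha) * alpha ^+ (i + m) by rewrite mulr_ge0 ?exprn_ge0// subr_ge0 ltW.
have := ler_wpM2l am (mc (i + m)%N); lra.
Qed.

End discounted.

End plan.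

Lemma Enext_cvg (phi_ : nat -> rV -> R) phi B y u :
  (forall j, measurable_fun (Y : set (borel rV)) (phi_ j : borel rV -> R)) ->
  (forall j, bounded_on (phi_ j) B) ->
  (forall y, Y y -> phi_ j y @[j --> \oo] --> phi y) -> gr (y, u) ->
  Enext P s f (phi_ j) y u @[j --> \oo] --> Enext P s f phi y u.
Proof.
move=> mphi phiB phic yu.
have Yf w : Y (f y u (s 0%N w)) by case: yu => *; exact: f_invariant.
apply: (@cvg_Rintegral_bounded _ _ _ P setT _ _ B) => //.
- by move=> j; exact: measurable_next.
- by move=> j w _; exact: phiB.
- by move=> w _; exact: phic.
Qed.

(** Weak Feller property on the graph of [U], by dominated convergence. *)
Lemma Enext_continuous phi B : continuous phi -> bounded_on phi B ->
  {within (gr : set (rV * Uhat)), continuous (fun p : rV * Uhat => Enext P s f phi p.1 p.2)}.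
Proof.
move=> phic phiB.
apply: (@within_continuous_Rintegral R _ _ P (rV * Uhat)%type gr
  (fun p w => phi (f p.1 p.2 (s 0%N w))) B).
- move=> w; apply: (@within_comp_continuous (rV * Uhat)%type rV R gr
    (fun p => f p.1 p.2 (s 0%N w))) => //.
  exact: (continuous_subspaceW subset_G_YU (@f_continuous (s 0%N w))).
- move=> [y u] yu; apply: measurable_next => //.
  apply: within_continuous_measurable; first exact: closedY.
  exact: continuous_subspaceT.
- by move=> [y u] w [/= Yy Uy]; apply: phiB; exact: f_invariant.
Qed.


Lemma lsc_fst (phi : rV -> R) : lsc_on Y phi ->
  lsc_on (gr : set (rV * Uhat)) (fun p : rV * Uhat => phi p.1).
Proof.
move=> phil c.
rewrite (_ : _ `&` _ = (gr : set (rV * Uhat)) `&` fst @^-1` (Y `&` [set y | phi y <= c])).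
  apply: closedI; first exact: closedG.
  by apply: preimage_closed => [p _|]; [exact: cvg_fst|exact: phil].
by apply/seteqP; split => p [Gp]; [case: Gp|case].
Qed.

(** * The Bellman operator on lower semicontinuous functions *)

Section bellman.
Variable alpha : R.
Hypothesis alpha0 : 0 <= alpha.

Definition q_value (phi : rV -> R) (p : rV * Uhat) :=
  k p.1 p.2 + alpha * Enext P s f phi p.1 p.2.

Definition bellman (phi : rV -> R) (y : rV) := inf [set q_value phi (y, u) | u in U y].

Lemma lsc_approxY phi B : Y !=set0 -> bounded_on phi B -> lsc_on Y phi ->
  exists phi_ : nat -> rV -> R,
  [/\ forall j, continuous (phi_ j), forall j, bounded_on (phi_ j) B,
      forall j, measurable_fun (Y : set (borel rV)) (phi_ j : borel rV -> R),
      forall j y, Y y -> phi_ j y <= phi y &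
      forall y, Y y -> phi_ j y @[j --> \oo] --> phi y].
Proof.
move=> Yne phiB phil; have [phi_ [h1 h2 h3 h4]] := lsc_approx Yne phiB phil.
exists phi_; split => // j; apply: within_continuous_measurable.
  exact: closedY.
exact: continuous_subspaceT.
Qed.

(** Continuous approximations of [phi] from below have continuous expectations that stay below that
    of [phi] and converge to it, so [lsc_on_limit] applies. For [q_value], the sign of [alpha]
    preserves the inequality. *)
Lemma lsc_Enext phi B : Y !=set0 -> bounded_on phi B -> lsc_on Y phi ->
  lsc_on (gr : set (rV * Uhat)) (fun p : rV * Uhat => Enext P s f phi p.1 p.2) /\
  lsc_on (gr : set (rV * Uhat)) (q_value phi).
Proof.
move=> Yne phiB phil;
have [phi_ [phic phi_B mphi_ phi_le phi_cvg]] := lsc_approxY Yne phiB phil.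
have mphi := lsc_measurable closedY phil.
have En_c j := Enext_continuous (phic j) (phi_B j).
have En_cvg p : gr p -> Enext P s f (phi_ j) p.1 p.2 @[j --> \oo] --> Enext P s f phi p.1 p.2.
  by case: p => y u yu; exact: (Enext_cvg mphi_ phi_B phi_cvg).
have En_le j p : gr p -> Enext P s f (phi_ j) p.1 p.2 <= Enext P s f phi p.1 p.2.
  case: p => y u yu.
  have Yf w : Y (f y u (s 0%N w)) by case: yu => *; exact: f_invariant.
  apply: le_Rintegral => //.
  - apply: (@integrable_bounded _ _ _ _ _ _ B) => //; first exact: measurable_next.
    by move=> w _; exact: phi_B.
  - apply: (@integrable_bounded _ _ _ _ _ _ B) => //; first exact: measurable_next.
    by move=> w _; exact: phiB.
  - by move=> w _; exact: phi_le.
split; first exact: (lsc_on_limit closedG En_c).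
apply: (@lsc_on_limit _ _ _ (fun j => q_value (phi_ j))) => //.
- exact: closedG.
- move=> j; apply/subspace_continuousP => p Gp; apply: cvgD.
    have kG : {within (gr : set (rV * Uhat)), continuous (fun p : rV * Uhat => k p.1 p.2)}.
      exact: (continuous_subspaceW subset_G_YU k_continuous).
    exact: (proj1 (subspace_continuousP _ _) kG p Gp).
  by apply: cvgMl_tmp; exact: (proj1 (subspace_continuousP _ _) (En_c j) p Gp).
- by move=> j p Gp; rewrite lerD2l; apply: ler_wpM2l => //; exact: En_le.
- by move=> p Gp; apply: cvgD; [exact: cvg_cst|apply: cvgMl_tmp; exact: En_cvg].
Qed.


Lemma q_value_bounded C phi B p : (forall y u, Y y -> `|k y u| <= C) ->
  bounded_on phi B -> lsc_on Y phi -> gr p -> `|q_value phi p| <= C + alpha * B.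
Proof.
move=> kC phiB phil; case: p => y u yu.
apply: le_trans (ler_normD _ _) _; apply: lerD; first by apply: kC; case: yu.
rewrite normrM ger0_norm//; apply: ler_wpM2l => //.
exact: (Enext_bounded (lsc_measurable closedY phil)).
Qed.

Section bellman_step.
Variables (phi : rV -> R) (B : R).
Hypotheses (phiB : bounded_on phi B) (phil : lsc_on Y phi) (Yne : Y !=set0).
Let q := q_value phi.

Let qb : exists Q : R, forall p, gr p -> `|q p| <= Q.
Proof.
have [C kC] := k_bounded; exists (C + alpha * B) => p Gp.
exact: q_value_bounded.
Qed.

Let ql := (lsc_Enext Yne phiB phil).2.

Lemma bellman_le y u : gr (y, u) -> bellman phi y <= q (y, u).
Proof.
move=> [/= Yy Uyu]; apply: ge_inf; last by exists u.
have [Q qQ] := qb; exists (- Q) => _ [v Uyv <-].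
by have := qQ (y, v) (conj Yy Uyv); rewrite ler_norml => /andP[].
Qed.

Let slice_closed y D c : Y y -> closed D ->
  closed ((U y `&` D) `&` [set u | q (y, u) <= c]).
Proof.
move=> Yy Dcl.
rewrite (_ : _ `&` _ = D `&` (pair y @^-1` ((gr : set (rV * Uhat)) `&` [set p | q p <= c]))).
  apply: closedI => //; apply: preimage_closed; last exact: ql.
  move=> u _ W [[A1 A2] /= [A1y A2u] sub]; apply: (filterS _ A2u) => v A2v /=.
  by apply: sub; split => //=; exact: nbhs_singleton.
by apply/seteqP; split => [u [[Uu Du] qu]|u [Du [[_ Uu] qu]]]; repeat split.
Qed.

Let slice_argmin y D : Y y -> closed D -> U y `&` D !=set0 ->
  exists2 u, (U y `&` D) u & forall v, (U y `&` D) v -> q (y, u) <= q (y, v).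
Proof.
move=> Yy Dcl ne; apply: (@compact_argmin _ _ _ (fun u => q (y, u))) => //.
- apply: (subclosed_compact _ (U_compact Yy)); last by move=> u [].
  apply: closedI => //; exact: compact_closed (@metric_hausdorff _ _) (U_compact Yy).
- by move=> c; exact: slice_closed.
- have [Q qQ] := qb; exists (- Q) => u [Uyu _].
  by have := qQ (y, u) (conj Yy Uyu); rewrite ler_norml => /andP[].
Qed.

Lemma bellman_attained y : Y y -> exists2 u, U y u & q (y, u) <= bellman phi y.
Proof.
move=> Yy; have ne : U y `&` setT !=set0 by rewrite setIT; exact: U_nonempty.
have [u [Uu _] umin] := slice_argmin Yy closedT ne.
exists u => //; apply: lb_le_inf => [|_ [v Uv <-]]; first by exists (q (y, u)), u.
exact: umin.
Qed.

(** The graph is compact, so the projection of a closed part of it is compact. The set [D] is there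
    for the hitting sets in [bellman_selector]. *)
Let proj_closed (D : set Uhat) c : closed D ->
  closed [set y | exists u, [/\ gr (y, u), D u & q (y, u) <= c]].
Proof.
move=> Dcl.
rewrite (_ : [set _ | _] = fst @` ((gr `&` [set p | q p <= c]) `&` snd @^-1` D)).
  apply: (compact_closed (@norm_hausdorff _ _)); apply: continuous_compact.
    by apply: continuous_subspaceT => p; exact: cvg_fst.
  apply: (subclosed_compact _ compactG) => [|p [[]//]].
  apply: closedI; first exact: ql.
  by apply: preimage_closed => // p _; exact: cvg_snd.
apply/seteqP; split => [y [u [? ? ?]]|_ [[y u] [[? ?] ?] <-]]; last by exists u.
by exists (y, u).
Qed.

Lemma lsc_bellman : lsc_on Y (bellman phi).
Proof.
move=> c.
rewrite (_ : _ `&` _ = [set y | exists u, [/\ gr (y, u), setT u & q (y, u) <= c]]).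
  by apply: proj_closed; exact: closedT.
apply/seteqP; split => [y [Yy /= byc]|y [u [yu _ quc]]].
  have [u Uu qu] := bellman_attained Yy; exists u; split => //; exact: le_trans byc.
split; first by case: yu.
by apply: le_trans quc; exact: bellman_le.
Qed.

Lemma bellman_bounded C : (forall y u, Y y -> `|k y u| <= C) ->
  bounded_on (bellman phi) (C + alpha * B).
Proof.
move=> kC y Yy; have [u Uu qu] := bellman_attained Yy.
have -> : bellman phi y = q (y, u).
  by apply/eqP; rewrite eq_le qu bellman_le.
exact: q_value_bounded.
Qed.

Lemma bellman_selector : exists sigma : rV -> Uhat,
  measurable_fun (Y : set (borel rV)) (sigma : borel rV -> borel Uhat) /\
  forall y, Y y -> U y (sigma y) /\ q (y, sigma y) <= bellman phi y.
Proof.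
have mb := lsc_measurable closedY lsc_bellman.
apply: (@measurable_selection R _ (borel rV) Uhat Y
  (fun y => [set u | U y u /\ q (y, u) <= bellman phi y])).
- exact: measurableY.
- exact: Uhat_compact.
- by move=> y /bellman_attained[u Uu qu]; exists u.
- move=> y Yy; have := @slice_closed y setT (bellman phi y) Yy closedT.
  by rewrite setIT.
move=> D Dcl.
pose Pr c := [set y | exists u, [/\ gr (y, u), D u & q (y, u) <= c]].
(* The level [bellman phi y] varies with [y], so hitting [D] is tested at rational levels: whenever
   [ratr r] is at least [bellman phi y], some control in [D] has value at most [ratr r]. Each test
   is Borel by [lsc_bellman] and [proj_closed]. *)
rewrite (_ : _ `&` _ = \bigcap_(r : rat)
    ((Y `\` (Y `&` [set y | bellman phi y <= ratr r])) `|` Pr (ratr r))).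
  rewrite -[X in measurable X]setCK setC_bigcap; apply: measurableC.
  apply: bigcupT_measurable_rat => r; apply: measurableC; apply: measurableU; last first.
    by apply: closed_measurable_borel; exact: proj_closed.
  apply: measurableD; first exact: measurableY.
  by apply: closed_measurable_borel; exact: lsc_bellman.
apply/seteqP; split => [y [Yy [u [[Uu qu] Du]]] r _|y H].
  have [br|rb] := lerP (bellman phi y) (ratr r).
    by right; exists u; split => //; apply: le_trans br.
  by left; split => // -[_ /=]; rewrite leNgt rb.
have Yy : Y y.
  by have [[]//|[u [[] //]]] := H 0 I.
split => //.
have hit (r : rat) : bellman phi y <= ratr r -> exists u, [/\ U y u, D u & q (y, u) <= ratr r].
  move=> br; have [[_ nb]|[u [[_ Uu] Du qu]]] := H r I.
    by exfalso; apply: nb.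
  by exists u.
have hitD : U y `&` D !=set0.
  have [|r] := @rat_in_itvoo R (bellman phi y) (bellman phi y + 1).
    by rewrite ltrDl.
  by rewrite in_itv /= => /andP[/ltW /hit[u [Uu Du _]] _]; exists u.
have [u [Uu Du] umin] := slice_argmin Yy Dcl hitD.
exists u; split => //; split => //=.
rewrite leNgt; apply/negP => /rat_in_itvoo[r].
rewrite in_itv /= => /andP[/ltW/hit[v [Uv Dv qv]] ru].
by have := le_lt_trans (le_trans (umin v (conj Uv Dv)) qv) ru; rewrite ltxx.
Qed.

End bellman_step.


(** * Balance equations for semicontinuous test functions *)

Section test_functions.
Variables (phi : rV -> R) (B : R).
Hypotheses (Yne : Y !=set0) (phiB : bounded_on phi B) (phil : lsc_on Y phi).

Lemma bounded_fst : bounded_measurable gr (fun p : borel (rV * Uhat)%type => phi p.1).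
Proof.
split; first exact: (lsc_measurable closedG (lsc_fst phil)).
by exists B => -[y u] [Yy _]; exact: phiB.
Qed.

Lemma bounded_Enext :
  bounded_measurable gr (fun p : borel (rV * Uhat)%type => Enext P s f phi p.1 p.2).
Proof.
split; first exact: (lsc_measurable closedG (lsc_Enext Yne phiB phil).1).
by exists B => -[y u] yu; exact: (Enext_bounded (lsc_measurable closedY phil)).
Qed.
End test_functions.

Lemma bounded_k : bounded_measurable gr (fun p : borel (rV * Uhat)%type => k p.1 p.2).
Proof.
split.
  exact: (within_continuous_measurable closedG (continuous_subspaceW subset_G_YU k_continuous)).
by have [C kC] := k_bounded; exists C => -[y u] [Yy _]; exact: kC.
Qed.

Section balance.
Variables (phi : rV -> R) (B : R).
Hypotheses (Yne : Y !=set0) (phiB : bounded_on phi B) (phil : lsc_on Y phi).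

(* The balance equations are imposed on continuous test functions only; they
   pass to semicontinuous ones by dominated convergence. *)
Lemma balance_approx : exists phi_ : nat -> rV -> R,
  [/\ forall j, contY Y (phi_ j), forall y, Y y -> phi_ j y @[j --> \oo] --> phi y,
    forall m : {finite_measure set (borel (rV * Uhat)%type) -> \bar R},
      \int[m]_(p in gr) (Enext P s f (phi_ j) p.1 p.2 - phi_ j p.1) @[j --> \oo] -->
      \int[m]_(p in gr) (Enext P s f phi p.1 p.2 - phi p.1) &
    forall m : {finite_measure set (borel (rV * Uhat)%type) -> \bar R}, forall y0, Y y0 ->
      \int[m]_(p in gr) (phi_ j y0 - phi_ j p.1) @[j --> \oo] -->
      \int[m]_(p in gr) (phi y0 - phi p.1)].
Proof.
have [phi_ [phic phi_B mphi_ _ phi_cvg]] := lsc_approxY Yne phiB phil.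
have phi_c j : contY Y (phi_ j) by exact: continuous_subspaceT.
have phi_l j := within_continuous_lsc closedY (phi_c j).
exists phi_; split => // [m|m y0 Yy0].
  apply: (@cvg_Rintegral_bounded _ _ _ m gr _ _ (B + B)); first exact: measurableG.
  - by move=> j; apply: measurable_funB;
      [case: (bounded_Enext Yne (phi_B j) (phi_l j))|case: (bounded_fst (phi_B j) (phi_l j))].
  - move=> j [y u] yu; apply: le_trans (ler_normB _ _) _; apply: lerD.
      exact: (Enext_bounded (mphi_ j) (phi_B j) yu).
    by apply: phi_B; case: yu.
  - move=> [y u] yu; apply: cvgB; first exact: (Enext_cvg mphi_ phi_B phi_cvg yu).
    by apply: phi_cvg; case: yu.
apply: (@cvg_Rintegral_bounded _ _ _ m gr _ _ (B + B)); first exact: measurableG.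
- by move=> j; apply: measurable_funB => //; case: (bounded_fst (phi_B j) (phi_l j)).
- move=> j [y u] [Yy _]; apply: le_trans (ler_normB _ _) _; apply: lerD.
    exact: phi_B.
  exact: phi_B.
- by move=> [y u] [Yy _]; apply: cvgB; exact: phi_cvg.
Qed.

Lemma W_lsc gamma : W P s Y f U gamma ->
  \int[gamma]_(p in gr) Enext P s f phi p.1 p.2 = \int[gamma]_(p in gr) phi p.1.
Proof.
move=> [_ Wg]; apply/eqP; rewrite -subr_eq0; apply/eqP.
rewrite -Rintegral_bmB; [|exact: measurableG
  |exact: bounded_Enext phiB phil|exact: bounded_fst phiB phil].
have [phi_ [phi_c _ cv _]] := balance_approx.
have := cv gamma; under eq_cvg do rewrite Wg//.
by move/(cvg_lim (@Rhausdorff R)) => <-; rewrite lim_cst.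
Qed.

Lemma Omega_lsc y0 gamma xi : Y y0 -> Omega P s Y f U y0 gamma xi ->
  \int[gamma]_(p in gr) (phi y0 - phi p.1) +
  \int[xi]_(p in gr) (Enext P s f phi p.1 p.2 - phi p.1) = 0.
Proof.
move=> Yy0 [_ _ _ Om0].
have [phi_ [phi_c _ cv1 cv2]] := balance_approx.
have cv : cst 0 @ \oo --> \int[gamma]_(p in gr) (phi y0 - phi p.1) +
    \int[xi]_(p in gr) (Enext P s f phi p.1 p.2 - phi p.1).
  apply: cvg_trans (cvgD (cv2 gamma y0 Yy0) (cv1 xi)).
  by apply: near_eq_cvg; apply: nearW => j; exact: Om0.
by rewrite -(cvg_lim (@Rhausdorff R) cv) lim_cst.
Qed.
End balance.

(** * Value iteration *)

Section value_iteration.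
Hypotheses (alpha1 : alpha <= 1) (Yne : Y !=set0).
Variable C : R.
Hypothesis kC : forall y u, Y y -> `|k y u| <= C.

Fixpoint value m := if m is m'.+1 then bellman (value m') else fun=> 0.

Let C0 : 0 <= C.
Proof. by case: Yne => y Yy; exact: le_trans (normr_ge0 _) (kC point Yy). Qed.

(** For [alpha = 1] the bound grows linearly in [m]; [value_Omega] uses its size only after
    multiplication by [1 - alpha], where it is at most [C]. *)
Lemma value_spec m :
  lsc_on Y (value m) /\ bounded_on (value m) (C * \sum_(t < m) alpha ^+ t).
Proof.
elim: m => [|m [IHl IHb]].
  split; last by move=> y _ /=; rewrite big_ord0 mulr0 normr0.
  have c0 : {within Y, continuous (value 0)}.
    by apply: continuous_subspaceT; exact: cst_continuous.
  exact: (within_continuous_lsc closedY c0).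
split; first exact: (lsc_bellman IHb IHl Yne).
have -> : \sum_(t < m.+1) alpha ^+ t = 1 + alpha * \sum_(t < m) alpha ^+ t.
  rewrite big_ord_recl expr0 big_distrr /=; congr (_ + _).
  by apply: eq_bigr => i _; rewrite exprS.
by rewrite mulrDr mulr1 mulrCA; exact: (bellman_bounded IHb IHl Yne kC).
Qed.

Lemma measurable_value m :
  measurable_fun (Y : set (borel rV)) (value m : borel rV -> R).
Proof. exact: (lsc_measurable closedY (value_spec m).1). Qed.

Lemma value_le m y u : gr (y, u) ->
  value m.+1 y <= k y u + alpha * Enext P s f (value m) y u.
Proof. by move=> yu; exact: (bellman_le (value_spec m).2 (value_spec m).1 yu). Qed.

(** Holds at [m = 0], as one stage costs at least [- C], and propagates because the Bellman operator
    is monotone and turns a shift by [C] into one by [alpha * C]. *)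
Lemma value_increment m y : Y y -> value m y - C <= value m.+1 y.
Proof.
elim: m y => [|m IH] y Yy.
  have := bellman_bounded (value_spec 0).2 (value_spec 0).1 Yne kC Yy.
  by rewrite big_ord0 !mulr0 addr0 ler_norml => /andP[+ _]; rewrite sub0r.
(* An optimal control for [value m.+2] serves as a competitor for [value m.+1]. *)
have [u Uu qu] := bellman_attained (value_spec m.+1).2 (value_spec m.+1).1 Yne Yy.
have yu : gr (y, u) by split.
apply: le_trans qu; rewrite lerBlDr; apply: le_trans (value_le m yu) _.
rewrite /q_value /= -addrA lerD2l.
have En_le : Enext P s f (value m) y u - C <= Enext P s f (value m.+1) y u.
  have bm j : bounded_measurable setT (fun w => value j (f y u (s 0%N w))).
    split; first by apply: measurable_next => //; exact: measurable_value.
    by exists (C * \sum_(t < j) alpha ^+ t) => w _; apply: (value_spec j).2; exact: f_invariant.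
  have bC := @bounded_measurable_cst _ Om R setT C.
  rewrite /Enext -[X in _ - X](Rintegral_prob_cst P C) -Rintegral_bmB//.
  apply: le_Rintegral_bm => //; first exact: bounded_measurableB.
  by move=> w _; apply: IH; exact: f_invariant.
have := ler_wpM2l alpha0 En_le; rewrite mulrBr.
have : alpha * C <= C by rewrite ler_piMl.
lra.
Qed.

(** Dynamic programming: with [m - t] stages left, the plan follows a selector attaining
    [value (m - t)]. It does not depend on the initial state. *)
Lemma value_plan m : exists pi, plan Y U pi /\
  forall y0, Y y0 -> \sum_(t < m) alpha ^+ t * mean_cost pi y0 t <= value m y0.
Proof.
have /choice[sigma sigmaP] j := bellman_selector (value_spec j).2 (value_spec j).1 Yne.
(* For [t >= m] the subtraction truncates; those controls do not matter. *)
pose pi t := sigma (m.-1 - t)%N.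
have pi_plan : plan Y U pi.
  by move=> t; have [m1 m2] := sigmaP (m.-1 - t)%N; split => // y Yy; case: (m2 y Yy).
exists pi; split => // y0 Yy0.
pose W j t := \int[P]_w value j (state s f pi y0 t w).
(* Cost so far plus expected value of the remaining stages does not increase with [t]. It starts at
   [value m y0] and, as [value 0] vanishes, ends at the total cost. *)
suff claim t : (t <= m)%N ->
    \sum_(i < t) alpha ^+ i * mean_cost pi y0 i + alpha ^+ t * W (m - t)%N t <= value m y0.
  have := claim m (leqnn m); rewrite subnn /W /=.
  by rewrite (Rintegral_prob_cst P 0) mulr0 addr0.
elim: t => [_|t IH tm].
  by rewrite big_ord0 add0r expr0 mul1r subn0 /W /= Rintegral_prob_cst.
apply: le_trans (IH (ltnW tm)); rewrite big_ord_recr/= -addrA lerD2l exprSr -mulrA -mulrDr.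
apply: ler_wpM2l; first exact: exprn_ge0.
have -> : (m - t = (m - t.+1).+1)%N by rewrite subnSK.
set j := (m - t.+1)%N.
have jE : (m.-1 - t = j)%N by rewrite /j subnS -subn1 subnAC subn1.
have bE := bounded_Enext_state pi_plan Yy0 t (measurable_value j) (value_spec j).2.
have bc := bounded_cost pi_plan Yy0 t.
rewrite /W (Enext_state pi_plan Yy0 t (measurable_value j) (value_spec j).2).2.
rewrite -Rintegral_bmZ// -Rintegral_bmD//; last exact: bounded_measurableZ.
apply: le_Rintegral_bm => //.
- by apply: bounded_measurableD => //; exact: bounded_measurableZ.
- exact: (bounded_state pi_plan Yy0 t (measurable_value j.+1) (value_spec j.+1).2).
- move=> w _; have Yx := state_in pi_plan Yy0 t w.
  have [_ /(_ _ Yx)[_]] := sigmaP j.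
  by rewrite /stage_cost /control /pi jE.
Qed.


Lemma value_Omega gamma xi m y0 : Y y0 -> Omega P s Y f U y0 gamma xi ->
  value m y0 <= (\int[gamma]_(p in gr) k p.1 p.2) * (\sum_(t < m) alpha ^+ t) +
    3 * C * fine (xi gr).
Proof.
move=> Yy0 Omg; have [Gg Gx Wg _] := Omg.
set A := \int[gamma]_(p in gr) k p.1 p.2.
have gG : fine (gamma gr) = 1.
  have := probability_setC gamma measurableG; rewrite Gg => /esym/eqP.
  by rewrite sube_eq ?add0e//= => /eqP <-.
pose a j := \int[gamma]_(p in gr) value j p.1.
have bV j := bounded_fst (value_spec j).2 (value_spec j).1.
have bE j := bounded_Enext Yne (value_spec j).2 (value_spec j).1.
have mG := measurableG.
(* [W_lsc] replaces the integral of [Enext] by that of [value j], so integrating [value_le] gives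
   [a j.+1 <= A + alpha * a j]. *)
have a_le j : a j <= A * \sum_(t < j) alpha ^+ t.
  elim: j => [|j IH].
    rewrite big_ord0 mulr0 /a (@eq_Rintegral _ _ _ _ _ (cst 0)) ?Rintegral_cst ?mul0r//.
  rewrite big_ord_recl expr0 mulrDr mulr1
    (eq_bigr (fun i : 'I_j => alpha * alpha ^+ i)); last first.
    by move=> i _; rewrite exprS.
  rewrite -big_distrr/= mulrCA.
  apply: (@le_trans _ _ (A + alpha * a j)); last by rewrite lerD2l ler_wpM2l.
  rewrite /a -(W_lsc Yne (value_spec j).2 (value_spec j).1 Wg) -Rintegral_bmZ// -Rintegral_bmD//.
  - apply: le_Rintegral_bm => //.
      by apply: bounded_measurableD; [exact: bounded_k|exact: bounded_measurableZ].
    by move=> [y u] yu; exact: value_le.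
  - exact: bounded_k.
  - exact: bounded_measurableZ.
have := Omega_lsc Yne (value_spec m).2 (value_spec m).1 Yy0 Omg.
rewrite Rintegral_bmB//; last exact: bounded_measurable_cst.
rewrite (Rintegral_cst gamma mG) gG mulr1 => eq0.
suff : - (3 * C) * fine (xi gr) <=
    \int[xi]_(p in gr) (Enext P s f (value m) p.1 p.2 - value m p.1).
  by have := a_le m; rewrite /a; lra.
rewrite -(Rintegral_cst xi mG); apply: le_Rintegral_bm => //.
- exact: bounded_measurable_cst.
- exact: bounded_measurableB.
(* Origin of [3 * C]: [value m] is at most [value m.+1 + C], hence at most [2 * C + alpha * E]; and
   [(1 - alpha) * E] is at least [- C], because [1 - alpha] times the geometric sum is at most
   one. *)
move=> [y u] yu /=; have Yy : Y y by case: yu.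
have := value_le m yu; have := value_increment m Yy; have := kC u Yy.
have := Enext_bounded (measurable_value m) (value_spec m).2 yu.
set E := Enext _ _ _ _ _ _; rewrite !ler_norml => /andP[E1 _] /andP[_ k2] h1 h2.
have S1 : (1 - alpha) * \sum_(t < m) alpha ^+ t <= 1.
  have := subrX1 alpha m; have : 0 <= alpha ^+ m by exact: exprn_ge0.
  by set Sm := \sum_(t < m) _; lra.
have a1 : 0 <= 1 - alpha by rewrite subr_ge0.
have := ler_wpM2l a1 E1; have := ler_wpM2l C0 S1; lra.
Qed.

End value_iteration.
End bellman.

(** * Bounds for a fixed horizon and for a fixed discount *)

Section bounds.
Variable y0 : rV.
Hypothesis Yy0 : Y y0.
Let Yne : Y !=set0 := ex_intro _ y0 Yy0.

Lemma sum_expr_geo (alpha : R) m :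
  (\sum_(t < m) alpha ^+ t) * (1 - alpha) = 1 - alpha ^+ m.
Proof. by have := subrX1 alpha m; set Sm := \sum_(t < m) _; lra. Qed.

Lemma v_ge_dual mu psi eta M T : dual_feasible P s Y f U k y0 mu psi eta ->
  bounded_on eta M -> (0 < T)%N ->
  ((mu - M *+ 2 / T%:R)%:E <= v P s Y f U k T y0)%E.
Proof.
move=> feas etaM T0; have TR : 0 < T%:R :> R by rewrite ltr0n.
rewrite /v (_ : mu - _ = T%:R^-1 * (mu * T%:R - M *+ 2)); last first.
  by field; rewrite gt_eqF.
rewrite EFinM; apply: lee_wpmul2l; first by rewrite lee_fin invr_ge0 ltW.
apply: le_ereal_inf_tmp => _ [pi pi_plan <-]; rewrite lee_fin (cost_mean pi_plan Yy0).
have one : 0 <= (1 : R) <= 1 by rewrite ler01 lexx.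
have := mean_cost_dual pi_plan Yy0 T one feas etaM.
under eq_bigr do rewrite expr1n.
under [X in _ <= X + _ -> _]eq_bigr do rewrite expr1n mul1r.
by rewrite sumr_const card_ord lerBlDr.
Qed.

(** The dynamic programming plan with [alpha = 1] is a competitor. The [xi] term of [value_Omega] is
    independent of [T], so averaging makes it decay like [1/T]. *)
Lemma v_le_Omega gamma xi C T : (forall y u, Y y -> `|k y u| <= C) ->
  Omega P s Y f U y0 gamma xi -> (0 < T)%N ->
  (v P s Y f U k T y0 <=
    (\int[gamma]_(p in gr) k p.1 p.2 + 3 * C * fine (xi gr) / T%:R)%:E)%E.
Proof.
move=> kC Om0 T0; have TR : 0 < T%:R :> R by rewrite ltr0n.
have [pi [pi_plan piV]] := value_plan ler01 Yne kC T.
have := value_Omega ler01 (lexx 1) Yne kC T Yy0 Om0.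
set A := \int[gamma]_(p in gr) k p.1 p.2 => VA.
rewrite /v (_ : A + _ = T%:R^-1 * (A * T%:R + 3 * C * fine (xi gr))); last first.
  by field; rewrite gt_eqF.
rewrite EFinM; apply: lee_wpmul2l; first by rewrite lee_fin invr_ge0 ltW.
apply: le_trans (ereal_inf_lbound _) _; first by exists pi.
rewrite lee_fin (cost_mean pi_plan Yy0).
have := le_trans (piV y0 Yy0) VA.
under eq_bigr do rewrite expr1n mul1r.
under [X in _ <= _ * X + _ -> _]eq_bigr do rewrite expr1n.
by rewrite sumr_const card_ord.
Qed.

(** [mean_cost_dual] holds for every truncation [m]; its geometric sum is explicit, and [m] is sent
    to infinity on both sides. *)
Lemma h_ge_dual mu psi eta M eps : dual_feasible P s Y f U k y0 mu psi eta ->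
  bounded_on eta M -> 0 < eps < 1 ->
  ((mu - M *+ 2 * eps)%:E <= h P s Y f U k eps y0)%E.
Proof.
move=> feas etaM /andP[e0 e1]; have [C kC] := k_bounded.
have al0 : 0 <= 1 - eps by rewrite subr_ge0 ltW.
have al1 : 1 - eps < 1 by rewrite gtrBl.
rewrite /h (_ : mu - _ = eps * (mu / eps - M *+ 2)); last by field; rewrite gt_eqF.
rewrite EFinM; apply: lee_wpmul2l; first by rewrite lee_fin ltW.
apply: le_ereal_inf_tmp => _ [pi pi_plan <-]; rewrite lee_fin.
have cv := total_cost_cvg pi_plan Yy0 al0 al1 kC.
have al01 : 0 <= 1 - eps <= 1 by rewrite al0 ltW.
have lb m := mean_cost_dual pi_plan Yy0 m al01 feas etaM.
have cv_pow : mu / eps * (1 - (1 - eps) ^+ m) - M *+ 2 @[m --> \oo] -->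
    mu / eps * (1 - 0) - M *+ 2.
  apply: cvgB; last exact: cvg_cst.
  apply: cvgMl_tmp; apply: cvgB; first exact: cvg_cst.
  by apply: cvg_expr; rewrite ger0_norm.
rewrite subr0 mulr1 in cv_pow.
apply: ler_cvg_to cv_pow cv _; apply: nearW => m.
rewrite lerBlDr; apply: le_trans (lb m); rewrite -sum_expr_geo opprB addrCA subrr addr0.
by rewrite mulrA mulrAC divfK ?gt_eqF.
Qed.

Lemma h_le_Omega gamma xi C eps : (forall y u, Y y -> `|k y u| <= C) ->
  Omega P s Y f U y0 gamma xi -> 0 < eps < 1 ->
  (h P s Y f U k eps y0 <=
    (\int[gamma]_(p in gr) k p.1 p.2 + 3 * C * fine (xi gr) * eps)%:E)%E.
Proof.
move=> kC Om0 /andP[e0 e1].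
have al0 : 0 <= 1 - eps by rewrite subr_ge0 ltW.
have al1 : 1 - eps < 1 by rewrite gtrBl.
apply/lee_addgt0Pr => e egt0.
set A := \int[gamma]_(p in gr) k p.1 p.2.
(* After normalisation, running an [m]-stage plan forever adds [C * (1 - eps) ^+ m] from the tail
   and [- A * (1 - eps) ^+ m] from the truncated geometric sum; [m] is chosen to make the two
   together at most [e]. *)
have [m mP] : exists m, `|C - A| * (1 - eps) ^+ m <= e.
  have : `|C - A| * (1 - eps) ^+ m @[m --> \oo] --> `|C - A| * 0.
    by apply: cvgMl_tmp; apply: cvg_expr; rewrite ger0_norm.
  rewrite mulr0 => /cvgrPdist_le/(_ e egt0)[m _ /(_ m (leqnn m))].
  by rewrite sub0r normrN ger0_norm ?mulr_ge0 ?exprn_ge0// => ?; exists m.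
have [pi [pi_plan piV]] := value_plan al0 Yne kC m.
have := value_Omega al0 (ltW al1) Yne kC m Yy0 Om0; rewrite -/A => VA.
have tail := total_cost_tail pi_plan Yy0 al0 al1 kC m.
rewrite /h.
apply: (@le_trans _ _ (eps%:E * (total_cost pi y0 (1 - eps))%:E)%E).
  apply: lee_wpmul2l; first by rewrite lee_fin ltW.
  by apply: ereal_inf_lbound; exists pi.
rewrite -EFinM -EFinD lee_fin.
have := ler_wpM2l (ltW e0) (le_trans (piV y0 Yy0) VA).
have := sum_expr_geo (1 - eps) m.
have : (C - A) * (1 - eps) ^+ m <= e.
  apply: le_trans mP; apply: ler_wpM2r; first exact: exprn_ge0.
  exact: ler_norm.
move: tail; rewrite opprB addrCA subrr addr0.
set J := \sum_(t < m) (1 - eps) ^+ t * _; set Sm := \sum_(t < m) (1 - eps) ^+ t.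
set tc := total_cost _ _ _; set am := (1 - eps) ^+ m.
move=> h1 h2 h3 h4.
have h5 : A * (Sm * eps) = A * (1 - am) by rewrite h3.
lra.
Qed.

End bounds.
End model.

(** * Passage to the limit *)

Section limit_bounds.
Context {T : choiceType} {X : filteredType T} {R : realType}.
Variables (F : set (set X)) (FF : ProperFilter F).
Implicit Type g : X -> \bar R.

(** An eventual upper bound [a + e] bounds the supremum over a set of the filter, hence the upper
    limit. A general filter serves both [\oo] and [0^'+]. *)
Lemma limf_esup_le g (a : R) :
  (forall e : R, 0 < e -> F [set x | g x <= (a + e)%:E]%E) ->
  (limf_esup g F <= a%:E)%E.
Proof.
move=> gF; apply/lee_addgt0Pr => e e0; rewrite limf_esupE.
apply: (@le_trans _ _ (ereal_sup [set g x | x in [set x | g x <= (a + e)%:E]%E])).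
  by apply: ereal_inf_lbound; exists [set x | g x <= (a + e)%:E]%E => //; exact: gF.
by apply: ge_ereal_sup => _ [x gx <-].
Qed.

Lemma limf_einf_ge g (a : R) :
  (forall e : R, 0 < e -> F [set x | (a - e)%:E <= g x]%E) ->
  (a%:E <= limf_einf g F)%E.
Proof.
move=> gF; rewrite /limf_einf leeNr -EFinN; apply: limf_esup_le => e e0.
by apply: filterS (gF e e0) => x /=; rewrite leeNl -EFinN opprD opprK.
Qed.

(** Two sets of a proper filter meet; a common point compares the infimum over one with the supremum
    over the other. *)
Lemma limf_einf_le_esup g : (limf_einf g F <= limf_esup g F)%E.
Proof.
rewrite /limf_einf !limf_esupE leeNl; apply: le_ereal_inf_tmp => _ [V1 FV1 <-].
rewrite leeNl; apply: le_ereal_inf_tmp => _ [V2 FV2 <-].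
have [x [V1x V2x]] := filter_ex (filterI FV1 FV2).
apply: (@le_trans _ _ (g x)); last by apply: ereal_sup_ubound; exists x.
by rewrite leeNl; apply: ereal_sup_ubound; exists x.
Qed.
End limit_bounds.

Lemma near_div_nat {R : realType} (K e : R) : 0 < e ->
  \forall T \near \oo, (0 < T)%N /\ K / T%:R <= e.
Proof.
move=> e0; near=> T.
have T0 : (0 < T)%N by near: T; exact: nbhs_infty_gt.
split=> //; rewrite ler_pdivrMr ?ltr0n// mulrC -ler_pdivrMr//; near: T.
exact: nbhs_infty_ger.
Unshelve. all: by end_near. Qed.

Lemma near_right_mul {R : realType} (K e : R) : 0 < e ->
  \forall x \near 0^'+, 0 < x < 1 /\ K * x <= e.
Proof.
(* [K] may be zero or negative; [|K| + 1] is a positive majorant to divide by. *)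
move=> e0; have d0 : 0 < e / (`|K| + 1) by rewrite divr_gt0// ltr_wpDl.
near=> x.
have x0 : 0 < x by near: x; exact: nbhs_right_gt.
have x1 : x < 1 by near: x; exact: nbhs_right_lt.
rewrite x0 x1; split=> //.
have xe : x <= e / (`|K| + 1) by near: x; exact: nbhs_right_le.
apply: (@le_trans _ _ ((`|K| + 1) * x)).
  apply: ler_wpM2r; first exact: ltW.
  by apply: le_trans (ler_norm _) _; rewrite lerDl.
by rewrite mulrC -ler_pdivlMr// ltr_wpDl.
Unshelve. all: by end_near. Qed.

Unset Implicit Arguments.

Theorem theorem4p2 (R : realType) (n : nat)
    (Y : set 'rV[R]_n) (Uhat : pmetricType R) (S : ptopologicalType)
    (f : 'rV[R]_n -> Uhat -> S -> 'rV[R]_n)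
    (U : 'rV[R]_n -> set Uhat) (k : 'rV[R]_n -> Uhat -> R)
    (d : measure_display) (Om : measurableType d) (P : probability Om R)
    (s : nat -> Om -> S)
    (Y_nonempty : Y !=set0) (Y_compact : compact Y)
    (Uhat_compact : compact [set: Uhat])
    (S_polish : polish_space R S)
    (f_bounded : exists M : R, forall y u z, Y y -> `|f y u z| <= M)
    (f_continuous : forall z, {within Y `*` [set: Uhat],
        continuous (fun p : 'rV[R]_n * Uhat => f p.1 p.2 z)})
    (f_measurable : forall y u, Y y ->
        measurable_fun [set: borel S] (f y u : borel S -> borel 'rV[R]_n))
    (s_iid : iid P s)
    (U_usc : upper_semicontinuous Y U)
    (U_nonempty : forall y, Y y -> U y !=set0)
    (U_compact : forall y, Y y -> compact (U y))
    (f_invariant : forall y u z, Y y -> U y u -> Y (f y u z))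
    (k_continuous : {within Y `*` [set: Uhat],
        continuous (fun p : 'rV[R]_n * Uhat => k p.1 p.2)}) :
  forall y0, Y y0 ->
    [/\ (dhat P s Y f U k y0 <= limn_einf (fun T => v P s Y f U k T y0))%E,
        (limn_einf (fun T => v P s Y f U k T y0)
           <= limn_esup (fun T => v P s Y f U k T y0))%E &
        (limn_esup (fun T => v P s Y f U k T y0) <= kstar P s Y f U k y0)%E]
    /\
    [/\ (dhat P s Y f U k y0
           <= limf_einf (fun eps : R => h P s Y f U k eps y0) 0^'+)%E,
        (limf_einf (fun eps : R => h P s Y f U k eps y0) 0^'+
           <= limf_esup (fun eps : R => h P s Y f U k eps y0) 0^'+)%E &
        (limf_esup (fun eps : R => h P s Y f U k eps y0) 0^'+
           <= kstar P s Y f U k y0)%E].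
Proof.
move=> y0 Yy0.
(* Common form of both lower bounds: [r] is the rate, [1/T] or [eps], at which the error vanishes
   along the filter [F]. *)
have dual_lower (T : choiceType) (X : filteredType T) (F : set (set X))
    (FF : ProperFilter F) (g : X -> \bar R) (r : X -> R) :
    (forall K e : R, 0 < e -> F [set x | K * r x <= e]) ->
    (forall mu psi eta M, dual_feasible P s Y f U k y0 mu psi eta ->
      bounded_on Y eta M -> F [set x | (mu - M *+ 2 * r x)%:E <= g x]%E) ->
    (dhat P s Y f U k y0 <= limf_einf g F)%E.
  move=> rF gF; apply: ge_ereal_sup => _ [mu [psi [eta [feas ->]]]].
  have [_ [_ [M etaM]] _] := feas.
  apply: limf_einf_ge => e e0.
  apply: filterS2 (rF (M *+ 2) e e0) (gF _ _ _ _ feas etaM) => x /= h1.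
  apply: le_trans; rewrite lee_fin; lra.
have [C kC] := k_bounded Y_compact Uhat_compact k_continuous.
(* Likewise for both upper bounds; if [Omega] is empty, [kstar] is [+oo] and the inequality is
   trivial. *)
have primal_upper (T : choiceType) (X : filteredType T) (F : set (set X))
    (FF : ProperFilter F) (g : X -> \bar R) (r : X -> R) :
    (forall K e : R, 0 < e -> F [set x | K * r x <= e]) ->
    (forall gamma xi, Omega P s Y f U y0 gamma xi ->
      F [set x | g x <= (\int[gamma]_(p in G Y U) k p.1 p.2 +
         3 * C * fine (xi (G Y U)) * r x)%:E]%E) ->
    (limf_esup g F <= kstar P s Y f U k y0)%E.
  move=> rF gF; apply: le_ereal_inf_tmp => _ [gamma [xi [Om0 ->]]].
  apply: limf_esup_le => e e0.
  apply: filterS2 (rF (3 * C * fine (xi (G Y U))) e e0) (gF _ _ Om0) => x /= h1 h2.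
  apply: le_trans h2 _; rewrite lee_fin; lra.
have div_small K (e : R) : 0 < e -> \forall T \near \oo, K * T%:R^-1 <= e.
  by move=> /(near_div_nat K); apply: filterS => T [].
have mul_small K (e : R) : 0 < e -> \forall x \near 0^'+, K * x <= e.
  by move=> /(near_right_mul K); apply: filterS => x [].
have T_pos : \forall T \near \oo, (0 < T)%N by exact: nbhs_infty_gt.
have eps_in : \forall x \near 0^'+, 0 < x < (1 : R).
  by apply: filterS (near_right_mul 0 ltr01) => x [].
have v_low mu psi eta M : dual_feasible P s Y f U k y0 mu psi eta -> bounded_on Y eta M ->
    \forall T \near \oo, ((mu - M *+ 2 * T%:R^-1)%:E <= v P s Y f U k T y0)%E.
  by move=> feas etaM; apply: filterS T_pos => T T0; apply: v_ge_dual feas etaM T0.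
have v_up gamma xi : Omega P s Y f U y0 gamma xi ->
    \forall T \near \oo, (v P s Y f U k T y0 <= (\int[gamma]_(p in G Y U) k p.1 p.2 +
         3 * C * fine (xi (G Y U)) * T%:R^-1)%:E)%E.
  by move=> Om0; apply: filterS T_pos => T T0; apply: v_le_Omega kC Om0 T0.
have h_low mu psi eta M : dual_feasible P s Y f U k y0 mu psi eta -> bounded_on Y eta M ->
    \forall eps \near 0^'+, ((mu - M *+ 2 * eps)%:E <= h P s Y f U k eps y0)%E.
  by move=> feas etaM; apply: filterS eps_in => eps eps01; apply: h_ge_dual feas etaM eps01.
have h_up gamma xi : Omega P s Y f U y0 gamma xi ->
    \forall eps \near 0^'+, (h P s Y f U k eps y0 <= (\int[gamma]_(p in G Y U) k p.1 p.2 +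
         3 * C * fine (xi (G Y U)) * eps)%:E)%E.
  by move=> Om0; apply: filterS eps_in => eps eps01; apply: h_le_Omega kC Om0 eps01.
split; split.
- exact: (dual_lower _ _ _ _ _ (fun T : nat => T%:R^-1)).
- exact: limf_einf_le_esup.
- exact: (primal_upper _ _ _ _ _ (fun T : nat => T%:R^-1)).
- exact: (dual_lower _ _ _ _ _ id).
- exact: limf_einf_le_esup.
- exact: (primal_upper _ _ _ _ _ id).
Qed.
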